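(* For each integer $n\geq 2$, there exist infinitely many (pairwise non-isomorphic) focused graphs $\Gamma$ such that the group $\mathrm{Out}(\mathrm{Out}(A_\Gamma))$ contains a subgroup isomorphic to $\mathrm{PGL}_{n}(\mathbb{Z})$.
   Context: Graphs are finite and simplicial. For a graph $\Gamma$ with vertex set $V$, the right-angled Artin group $A_\Gamma$ is the group with generating set $V$ and relations $uv=vu$ for each pair of adjacent vertices $u,v$. For $v\in V$, the link $\mathrm{lk}(v)$ is the set of vertices adjacent to $v$, and the star is $\mathrm{st}(v)=\mathrm{lk}(v)\cup\{v\}$. A vertex $u$ dominates a vertex $v$, written $v\leq u$, if $\mathrm{lk}(v)\subseteq \mathrm{st}(u)$. For a set of vertices $W$, $\Gamma\setminus W$ denotes the induced subgraph on $V\setminus W$. A graph $\Gamma$ is focused (at $c$) if it has a distinguished vertex $c$ such that: (i) whenever $v\leq u$ with $u\neq v$, one has $u=c$; (ii) $c$ is the only vertex whose star disconnects $\Gamma$, i.e. $\Gamma\setminus\mathrm{st}(c)$ is disconnected and $\Gamma\setminus\mathrm{st}(v)$ is connected for every vertex $v\neq c$. For a group $G$, $\mathrm{Out}(G)=\mathrm{Aut}(G)/\mathrm{Inn}(G)$. $\mathrm{PGL}_n(\mathbb{Z})=\mathrm{GL}_n(\mathbb{Z})/\{\pm I_n\}$. *)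

(* Defs.v *)
From HB Require Import structures.
From mathcomp Require Import all_boot all_order all_algebra.
From mathcomp Require Import boolp.

Set Implicit Arguments.
Unset Strict Implicit.
Unset Printing Implicit Defensive.

Import GRing.Theory.

Local Open Scope quotient_scope.
Local Open Scope group_scope.

(* MathComp quotients only finite groups; here the group [G] is arbitrary. *)

HB.mixin Record isConjClosed (G : groupType) (S : {pred G}) := {
  gpredCJ : forall x y : G, x \in S -> x ^ y \in S
}.

#[short(type="normalClosed")]
HB.structure Definition NormalClosed (G : groupType) :=
  {S of isConjClosed G S & GroupClosed G S}.

Section QuotientGroup.
Variables (G : groupType) (N : normalClosed G).

Definition coset_rel (x y : G) : bool := x^-1 * y \in N.

Lemma coset_rel_refl : reflexive coset_rel.
Proof. by move=> x; rewrite /coset_rel mulVg gpred1. Qed.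

Lemma coset_rel_sym : symmetric coset_rel.
Proof.
by move=> x y; rewrite /coset_rel -(gpredV N (x^-1 * y)) invgM invgK.
Qed.

Lemma coset_rel_trans : transitive coset_rel.
Proof.
move=> y x z xy yz; rewrite /coset_rel.
by have := gpredM _ _ xy yz; rewrite -mulgA mulVKg.
Qed.

Canonical coset_equiv :=
  EquivRel coset_rel coset_rel_refl coset_rel_sym coset_rel_trans.

Definition quotient_group : Type := {eq_quot coset_rel}.
HB.instance Definition _ := Choice.on quotient_group.
HB.instance Definition _ := EqQuotient.on quotient_group.

Lemma cosetP (x y : G) :
  reflect (\pi_quotient_group x = \pi_quotient_group y) (x^-1 * y \in N).
Proof. exact: (@eqquotP _ coset_rel quotient_group). Qed.

Definition quotient_mul (x y : quotient_group) : quotient_group :=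
  \pi_quotient_group (repr x * repr y).
Definition quotient_one : quotient_group := \pi_quotient_group 1.
Definition quotient_inv (x : quotient_group) : quotient_group :=
  \pi_quotient_group (repr x)^-1.

Lemma pi_quotientM (x y : G) :
  quotient_mul (\pi_quotient_group x) (\pi_quotient_group y) = \pi_quotient_group (x * y).
Proof.
rewrite /quotient_mul; set x' := repr _; set y' := repr _.
have /cosetP Nx : \pi_quotient_group x' = \pi_quotient_group x by rewrite reprK.
have /cosetP Ny : \pi_quotient_group y' = \pi_quotient_group y by rewrite reprK.
apply/cosetP; have := gpredM _ _ (gpredCJ _ y' Nx) Ny.
by rewrite /conjg invgM !mulgA mulgK.
Qed.

Lemma pi_quotientV (x : G) :
  quotient_inv (\pi_quotient_group x) = \pi_quotient_group x^-1.
Proof.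
rewrite /quotient_inv; set x' := repr _.
have /cosetP Nx : \pi_quotient_group x' = \pi_quotient_group x by rewrite reprK.
apply/cosetP; rewrite invgK -(gpredV N) invgM invgK.
by have := gpredCJ _ x'^-1 Nx; rewrite /conjg invgK mulgA mulVKg.
Qed.

Lemma quotient_mulA : associative quotient_mul.
Proof.
move=> x y z; rewrite -[x]reprK -[y]reprK -[z]reprK.
move: (repr x) (repr y) (repr z) => a b c.
by rewrite (pi_quotientM b c) (pi_quotientM a b) (pi_quotientM a) (pi_quotientM _ c) mulgA.
Qed.
Lemma quotient_mul1 : left_id quotient_one quotient_mul.
Proof. by move=> x; rewrite -[x]reprK pi_quotientM mul1g. Qed.
Lemma quotient_mulr1 : right_id quotient_one quotient_mul.
Proof. by move=> x; rewrite -[x]reprK pi_quotientM mulg1. Qed.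
Lemma quotient_mulV : left_inverse quotient_one quotient_inv quotient_mul.
Proof. by move=> x; rewrite -[x]reprK pi_quotientV pi_quotientM mulVg. Qed.
Lemma quotient_mulrV : right_inverse quotient_one quotient_inv quotient_mul.
Proof. by move=> x; rewrite -[x]reprK pi_quotientV pi_quotientM mulgV. Qed.

HB.instance Definition _ := isGroup.Build quotient_group
  quotient_mulA quotient_mul1 quotient_mulr1 quotient_mulV quotient_mulrV.

End QuotientGroup.

Section Automorphisms.
Variable G : groupType.

Record aut := Aut {
  aut_fun :> G -> G;
  autM : {morph aut_fun : x y / x * y};
  aut_bij : bijective aut_fun }.

HB.instance Definition _ := gen_eqMixin aut.
HB.instance Definition _ := gen_choiceMixin aut.

Lemma aut_ext (f g : aut) : f =1 g -> f = g.
Proof.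
case: f g => [f fM fb] [g gM gb] /= /funext fg; case: g / fg gM gb => gM gb.
by congr Aut; apply: Prop_irrelevance.
Qed.

Definition aut_one : aut :=
  @Aut id (fun _ _ => erefl) (Bijective (frefl id) (frefl id)).

Definition aut_mul (f g : aut) : aut.
Proof.
exists (f \o g); last exact: bij_comp (aut_bij f) (aut_bij g).
by move=> x y /=; rewrite !autM.
Defined.

Lemma aut_inv_ex (f : aut) : exists g : aut, cancel g f /\ cancel f g.
Proof.
have [g fK gK] := aut_bij f.
have gM : {morph g : x y / x * y}.
  by move=> x y; rewrite -{1}(gK x) -{1}(gK y) -autM fK.
by exists (Aut gM (Bijective gK fK)).
Qed.

Definition aut_inv (f : aut) : aut := projT1 (cid (aut_inv_ex f)).

Lemma aut_invK (f : aut) : cancel f (aut_inv f).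
Proof. by rewrite /aut_inv; case: cid => g []. Qed.
Lemma autKV (f : aut) : cancel (aut_inv f) f.
Proof. by rewrite /aut_inv; case: cid => g []. Qed.

Lemma aut_mulA : associative aut_mul.
Proof. by move=> f g h; apply: aut_ext. Qed.
Lemma aut_mul1 : left_id aut_one aut_mul.
Proof. by move=> f; apply: aut_ext. Qed.
Lemma aut_mulr1 : right_id aut_one aut_mul.
Proof. by move=> f; apply: aut_ext. Qed.
Lemma aut_mulV : left_inverse aut_one aut_inv aut_mul.
Proof. by move=> f; apply: aut_ext => x; apply: aut_invK. Qed.
Lemma aut_mulrV : right_inverse aut_one aut_inv aut_mul.
Proof. by move=> f; apply: aut_ext => x; apply: autKV. Qed.

HB.instance Definition _ := isGroup.Build aut
  aut_mulA aut_mul1 aut_mulr1 aut_mulV aut_mulrV.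

(* Conjugation is [x ^ g = g^-1 * (x * g)]. *)
Definition inn : {pred aut} :=
  [pred f : aut | `[< exists g : G, forall x, f x = x ^ g >]].

Lemma innP (f : aut) :
  reflect (exists g : G, forall x, f x = x ^ g) (f \in inn).
Proof. exact: asboolP. Qed.

Lemma inn1 : 1 \in inn.
Proof. by apply/innP; exists 1 => x; rewrite conjg1. Qed.
Lemma innM : mulg_closed inn.
Proof.
move=> f g /innP[a fE] /innP[b gE]; apply/innP; exists (b * a) => x.
by rewrite conjgM -gE -fE.
Qed.
Lemma innV : invg_closed inn.
Proof.
move=> f /innP[a fE]; apply/innP; exists a^-1 => x.
by rewrite -{2}(autKV f x) fE -conjgM mulgV conjg1.
Qed.
Lemma innJ (f h : aut) : f \in inn -> f ^ h \in inn.
Proof.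
move=> /innP[a fE]; apply/innP; exists (aut_inv h a) => x.
apply: (can_inj (aut_invK h)); rewrite [LHS]autKV /= fE.
have hV (y : G) : h y^-1 = (h y)^-1.
  apply: (mulgI (h y)); rewrite -autM !mulgV.
  by apply: (mulgI (h 1)); rewrite -autM !mulg1.
by rewrite /conjg !autM hV autKV.
Qed.

HB.instance Definition _ := isMulClosed.Build aut inn innM.
HB.instance Definition _ := isMul1Closed.Build aut inn inn1.
HB.instance Definition _ := isInvClosed.Build aut inn innV.
HB.instance Definition _ := isConjClosed.Build aut inn innJ.

Definition Out : groupType := quotient_group inn.

End Automorphisms.

Definition contains_copy (G H : groupType) : Prop :=
  exists (S : groupClosed G) (f : {multiplicative H -> G}),
    injective f /\ forall y : G, y \in S <-> exists x : H, f x = y.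

Section GeneralLinear.
Local Open Scope ring_scope.
Variable n : nat.

(* MathComp's ['GL_n[R]] requires a finite ring. *)
Record GLZ := MkGLZ { glz_val :> 'M[int]_n; glz_unit : glz_val \in unitmx }.

HB.instance Definition _ := [isSub for glz_val].
HB.instance Definition _ := [Choice of GLZ by <:].

Definition glz_one : GLZ := MkGLZ (unitmx1 int n).
Definition glz_mul (A B : GLZ) : GLZ.
Proof. by exists (A *m B); rewrite unitmx_mul !glz_unit. Defined.
Definition glz_inv (A : GLZ) : GLZ.
Proof. by exists (invmx A); rewrite unitmx_inv glz_unit. Defined.

Lemma glz_mulA : associative glz_mul.
Proof. by move=> A B C; apply: val_inj; apply: mulmxA. Qed.
Lemma glz_mul1 : left_id glz_one glz_mul.
Proof. by move=> A; apply: val_inj; apply: mul1mx. Qed.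
Lemma glz_mulr1 : right_id glz_one glz_mul.
Proof. by move=> A; apply: val_inj; apply: mulmx1. Qed.
Lemma glz_mulV : left_inverse glz_one glz_inv glz_mul.
Proof. by move=> A; apply: val_inj; apply: mulVmx (glz_unit A). Qed.
Lemma glz_mulrV : right_inverse glz_one glz_inv glz_mul.
Proof. by move=> A; apply: val_inj; apply: mulmxV (glz_unit A). Qed.

HB.instance Definition _ := isGroup.Build GLZ
  glz_mulA glz_mul1 glz_mulr1 glz_mulV glz_mulrV.

Definition pm1 : {pred GLZ} :=
  [pred A : GLZ | (A == 1%:M :> 'M[int]_n) || (A == - 1%:M :> 'M[int]_n)].

Lemma pm1_1 : 1%g \in pm1.
Proof. by rewrite inE eqxx. Qed.
Lemma pm1M : mulg_closed pm1.
Proof.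
move=> A B; rewrite !inE /= => /orP[]/eqP-> /orP[]/eqP->;
  by rewrite ?mul1mx ?mulNmx ?mul1mx ?opprK eqxx ?orbT.
Qed.
Lemma pm1J (A B : GLZ) : A \in pm1 -> (A ^ B)%g \in pm1.
Proof.
rewrite !inE /= => /orP[]/eqP->; rewrite ?mulNmx ?mulmxN mul1mx mulVmx ?eqxx ?orbT //;
  exact: glz_unit.
Qed.
Lemma pm1V : invg_closed pm1.
Proof.
move=> A Apm; suff -> : (A^-1 = A)%g by [].
apply: (mulgI A); rewrite mulgV; apply: val_inj.
by move: Apm; rewrite !inE /= => /orP[]/eqP->; rewrite ?mulNmx ?mul1mx ?opprK.
Qed.

HB.instance Definition _ := isMulClosed.Build GLZ pm1 pm1M.
HB.instance Definition _ := isMul1Closed.Build GLZ pm1 pm1_1.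
HB.instance Definition _ := isInvClosed.Build GLZ pm1 pm1V.
HB.instance Definition _ := isConjClosed.Build GLZ pm1 pm1J.

Definition PGLZ : groupType := quotient_group pm1.

End GeneralLinear.

Section Presentation.
Variable V : eqType.

(* The letter [(v, false)] stands for the generator [v], [(v, true)] for its
   formal inverse. *)
Definition word := seq (V * bool).

Definition flip (a : V * bool) : V * bool := (a.1, ~~ a.2).

Definition word_inv (w : word) : word := rev (map flip w).

Variable rels : word -> word -> Prop.

Inductive pres_eq : word -> word -> Prop :=
| pres_refl w : pres_eq w w
| pres_sym w1 w2 : pres_eq w1 w2 -> pres_eq w2 w1
| pres_trans w1 w2 w3 : pres_eq w1 w2 -> pres_eq w2 w3 -> pres_eq w1 w3
| pres_cat w1 w2 w1' w2' :
    pres_eq w1 w1' -> pres_eq w2 w2' -> pres_eq (w1 ++ w2) (w1' ++ w2')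
| pres_cancel a : pres_eq [:: a; flip a] [::]
| pres_rel w1 w2 : rels w1 w2 -> pres_eq w1 w2.

Definition pres_eqb (w1 w2 : {classic word}) : bool := `[< pres_eq w1 w2 >].

Lemma pres_eqb_refl : reflexive pres_eqb.
Proof. by move=> w; apply/asboolP/pres_refl. Qed.
Lemma pres_eqb_sym : symmetric pres_eqb.
Proof. by move=> w1 w2; apply/asboolP/asboolP => /pres_sym. Qed.
Lemma pres_eqb_trans : transitive pres_eqb.
Proof.
move=> w2 w1 w3 /asboolP h12 /asboolP h23.
by apply/asboolP; apply: pres_trans h12 h23.
Qed.

Canonical pres_equiv :=
  EquivRel pres_eqb pres_eqb_refl pres_eqb_sym pres_eqb_trans.

Definition presented : Type := {eq_quot pres_eqb}.
HB.instance Definition _ := Choice.on presented.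
HB.instance Definition _ := EqQuotient.on presented.

Lemma presP (w1 w2 : word) :
  pres_eq w1 w2 <-> \pi_presented w1 = \pi_presented w2.
Proof.
split=> [h|/(@eqquotP _ pres_eqb presented w1 w2)/asboolP //].
by apply/(@eqquotP _ pres_eqb presented w1 w2)/asboolP.
Qed.

Definition pres_mul (x y : presented) : presented :=
  \pi_presented (repr x ++ repr y).
Definition pres_one : presented := \pi_presented [::].
Definition pres_inv (x : presented) : presented := \pi_presented (word_inv (repr x)).

Lemma pi_presM (w1 w2 : word) :
  pres_mul (\pi_presented w1) (\pi_presented w2) = \pi_presented (w1 ++ w2).
Proof. by apply/presP; apply: pres_cat; apply/presP; rewrite reprK. Qed.

Lemma word_invK : involutive word_inv.
Proof.
move=> w; rewrite /word_inv map_rev revK -map_comp map_id_in // => -[a b] _.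
by rewrite /= /flip /= negbK.
Qed.

Lemma pres_word_mulrV (w : word) : pres_eq (w ++ word_inv w) [::].
Proof.
elim: w => [|a w IHw]; first exact: pres_refl.
have -> : (a :: w) ++ word_inv (a :: w)
    = [:: a] ++ (w ++ word_inv w) ++ [:: flip a].
  by rewrite /word_inv /= rev_cons -cats1 catA.
apply: pres_trans (pres_cancel a).
rewrite -[[:: a; flip a]]/([:: a] ++ [::] ++ [:: flip a]).
by apply: pres_cat (pres_refl _) _; apply: pres_cat IHw (pres_refl _).
Qed.

Lemma pi_pres_mulrV (x : presented) (w : word) :
  \pi_presented w = x -> pres_mul x (\pi_presented (word_inv w)) = pres_one.
Proof. by move=> <-; rewrite pi_presM; apply/presP/pres_word_mulrV. Qed.

Lemma pres_mulA : associative pres_mul.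
Proof.
move=> x y z; rewrite -[x]reprK -[y]reprK -[z]reprK.
move: (repr x) (repr y) (repr z) => a b c.
by rewrite (pi_presM b c) (pi_presM a b) (pi_presM a) (pi_presM _ c) catA.
Qed.
Lemma pres_mul1 : left_id pres_one pres_mul.
Proof. by move=> x; rewrite -[x]reprK pi_presM. Qed.
Lemma pres_mulr1 : right_id pres_one pres_mul.
Proof. by move=> x; rewrite -[x]reprK pi_presM cats0. Qed.
Lemma pres_mulrV : right_inverse pres_one pres_inv pres_mul.
Proof. by move=> x; apply: pi_pres_mulrV; rewrite reprK. Qed.
Lemma pres_mulV : left_inverse pres_one pres_inv pres_mul.
Proof.
move=> x; have := pres_word_mulrV (word_inv (repr x)); rewrite word_invK.
by move/presP; rewrite -pi_presM reprK.
Qed.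

HB.instance Definition _ := isGroup.Build presented
  pres_mulA pres_mul1 pres_mulr1 pres_mulV pres_mulrV.

End Presentation.

Record sgraph := SGraph {
  vertex :> finType;
  adj : rel vertex;
  adj_sym : symmetric adj;
  adj_irrefl : irreflexive adj }.

Definition sgraph_iso (G H : sgraph) : Prop :=
  exists f : G -> H, bijective f /\ forall x y, adj (f x) (f y) = adj x y.

Section Graph.
Variable G : sgraph.

Inductive raag_rel : word G -> word G -> Prop :=
| raag_comm u v : adj u v ->
    raag_rel [:: (u, false); (v, false)] [:: (v, false); (u, false)].

Definition raag : groupType := presented raag_rel.

Definition lk (v : G) : {set G} := [set u | adj v u].
Definition st (v : G) : {set G} := v |: lk v.
Definition dominates (u v : G) : bool := lk v \subset st u.

Section Delete.
Variable W : {set G}.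

Definition del_adj : rel {x : G | x \notin W} := fun x y => adj (val x) (val y).
Lemma del_sym : symmetric del_adj.
Proof. by move=> x y; apply: adj_sym. Qed.
Lemma del_irrefl : irreflexive del_adj.
Proof. by move=> x; apply: adj_irrefl. Qed.
Definition del_set : sgraph := SGraph del_sym del_irrefl.

End Delete.

(* The empty graph counts as connected. *)
Definition connected : Prop := forall x y : G, connect (@adj G) x y.

End Graph.

Definition focused_at (G : sgraph) (c : G) : Prop :=
  [/\ forall u v : G, dominates u v -> u <> v -> u = c,
      ~ connected (del_set (st c))
    & forall v : G, v <> c -> connected (del_set (st v))].

Definition focused (G : sgraph) : Prop := exists c : G, focused_at c.

(* Main.v *)
Require Import Defs.
From HB Require Import structures.
From mathcomp Require Import all_boot all_order all_algebra.
From mathcomp Require Import boolp zify.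

Set Implicit Arguments.
Unset Strict Implicit.
Unset Printing Implicit Defensive.

(** The graphs used here have no triangles and no squares, and every vertex has at
    least two neighbours, so no vertex dominates another one. Such a graph has a
    center [c] whose star splits it into n + 1 components, no other star
    disconnects it, and every symmetry of it fixes [c] and each component. Its
    right-angled Artin group A has few outer automorphisms. Up to inner
    automorphisms, the partial conjugations by [c] (one for each component) form a
    group Z^n, because conjugating all components at once is inner. Inversions of
    generators and symmetries of the graph generate a complement, which acts on Z^n
    by signs, and the inversion of [c] acts by -1 and is central in the complement.
    Every matrix in GL_n(Z) acts on Z^n and thereby gives an automorphism of Out A
    that is trivial on the complement. It is inner exactly for the matrices 1 and
    -1, whence PGL_n(Z) embeds in Out (Out A). This last step is [contains_PGL]. It
    is stated with a crossed homomorphism from Out A to Z^n in place of the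
    semidirect product.

    What has to be proved is that Out A is not larger. The tool is the geometry of
    walls in the Cayley graph of A. The parity of the number of crossings of a wall
    is well defined, and this gives half-spaces without normal forms for words. An
    element of minimal length in its conjugacy class moves the wall of each of its
    letters along an axis ([geodesic_skew]). If an element g skewers a wall, then
    every h that commutes with g has a positive power which stabilizes the wall up
    to a power of g ([skewers_centralizer]). For an automorphism f and a generator
    v, this is applied to the images of v and of its neighbours; as two links share
    at most one vertex, the image of v is conjugate to a generator or to the inverse
    of one ([aut_gen]). So f induces a symmetry of the graph with signs.

    If symmetry and signs are trivial, f maps each generator v to a conjugate by
    some g v. Attach to v and its inverse two half-spaces based at the inverse of
    g v. If these half-spaces are disjoint whenever their generators do not commute,
    a ping-pong argument shows that f is the identity ([region_pingpong]).
    Otherwise two of them are nested, and composing f with a partial conjugation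
    reduces the total length of the g v ([pure_step]). As only the star of [c]
    disconnects the graph, the partial conjugations that occur are inner or
    conjugations by powers of [c] ([pureP]).

    For the graphs, take a vertex [c] joined to l_j for j < M, and for each i <= n a
    cycle of length M - i whose j-th vertex is joined to l_j. The cycles have
    different lengths, so no symmetry of the graph permutes them. *)

Local Open Scope quotient_scope.
Local Open Scope group_scope.

(** * Integer powers in groups *)

Section IntegerPowers.
Variable T : groupType.
Implicit Types (x y : T) (j k : int).

Definition zpow x k : T :=
  match k with Posz n => x ^+ n | Negz n => x ^- n.+1 end.

Lemma zpow0 x : zpow x 0 = 1. Proof. by []. Qed.
Lemma zpow1 x : zpow x 1 = x. Proof. by []. Qed.
Lemma zpow_nat x (n : nat) : zpow x n%:Z = x ^+ n. Proof. by []. Qed.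

Lemma zpowS x k : zpow x (k + 1)%R = zpow x k * x.
Proof.
case: k => [n|[|n]]; first by rewrite -PoszD addn1 /= expgSr.
  by rewrite /= expg1 mulVg.
have -> : (Negz n.+1 + 1 = Negz n)%R by lia.
by rewrite /= [x ^+ n.+2]expgS invgM mulgVK.
Qed.

Lemma zpowP x k : zpow x (k - 1)%R = zpow x k * x^-1.
Proof. by rewrite -{2}[k](GRing.subrK 1%R) zpowS mulgK. Qed.

Lemma zpowD x j k : zpow x (j + k)%R = zpow x j * zpow x k.
Proof.
elim/int_rec: k => [|n IH|n IH]; first by rewrite GRing.addr0 mulg1.
  by rewrite -addn1 PoszD GRing.addrA !zpowS IH mulgA.
have -> : (j - n.+1%:Z = j - n%:Z - 1)%R by lia.
have -> : (- n.+1%:Z = - n%:Z - 1)%R by lia.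
by rewrite !zpowP IH mulgA.
Qed.

Lemma zpowN x k : zpow x (- k)%R = (zpow x k)^-1.
Proof. by apply: (mulgI (zpow x k)); rewrite -zpowD GRing.subrr mulgV. Qed.

Lemma commute_zpow x y k : commute x y -> commute x (zpow y k).
Proof.
by case: k => n xy; rewrite /zpow; [apply: commuteX|apply/commuteV/commuteX].
Qed.

Lemma zpowJ x y k : zpow (x ^ y) k = zpow x k ^ y.
Proof. by case: k => n; rewrite /zpow ?conjVg conjXg. Qed.

Lemma commuteJ x y z : commute x y -> commute (x ^ z) (y ^ z).
Proof. by rewrite /commute -!conjMg => ->. Qed.

Lemma conjg_commute x y : commute x y -> x ^ y = x.
Proof. by move=> xy; rewrite conjgE xy mulKg. Qed.

End IntegerPowers.

(** * Words, exponent sums and standard subgroups of right-angled Artin groups *)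

Section Raag.
Variable G : sgraph.
Local Notation A := (raag G).
Local Notation letter := (G * bool)%type.
Implicit Types (a b : letter) (w : word G) (x y : A) (u v : G).

Definition el w : A := \pi_(presented (@raag_rel G)) w.
Definition ltr a : A := el [:: a].
Definition gen v : A := ltr (v, false).

Lemma elP w1 w2 : pres_eq (@raag_rel G) w1 w2 <-> el w1 = el w2.
Proof. exact: presP. Qed.

Lemma el_nil : el [::] = 1. Proof. by []. Qed.

Lemma el_cat w1 w2 : el (w1 ++ w2) = el w1 * el w2.
Proof. by rewrite /el -[LHS]pi_presM. Qed.

Lemma el_cons a w : el (a :: w) = ltr a * el w.
Proof. by rewrite -el_cat. Qed.

Lemma el_rcons w a : el (rcons w a) = el w * ltr a.
Proof. by rewrite -cats1 el_cat. Qed.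

Lemma el_surj x : exists w, x = el w.
Proof. by exists (repr x); rewrite /el reprK. Qed.

Lemma flipK : involutive (@flip G).
Proof. by case=> v e; rewrite /flip /= negbK. Qed.

Lemma flip_neq a : (flip a == a) = false.
Proof. by case: a => v []; apply/eqP => -[]. Qed.

Lemma ltr_flip a : ltr (flip a) = (ltr a)^-1.
Proof.
apply: (mulgI (ltr a)); rewrite mulgV -el_cat.
by apply/elP; apply: pres_cancel.
Qed.

Lemma ltr_true v : ltr (v, true) = (gen v)^-1.
Proof. by rewrite -ltr_flip. Qed.

Lemma el_inv w : el (word_inv w) = (el w)^-1.
Proof.
apply: (mulgI (el w)); rewrite mulgV -el_cat -el_nil.
by apply/elP/pres_word_mulrV.
Qed.

(** Induction along a path of the Cayley graph: right multiplication by a letter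
    moves to a neighbour. *)
Lemma raag_indr (P : A -> Prop) :
  P 1 -> (forall x a, P x -> P (x * ltr a)) -> forall x, P x.
Proof.
move=> P1 PS x; have [w ->] := el_surj x.
by elim/last_ind: w => [//|w a IH]; rewrite el_rcons; apply: PS.
Qed.

Lemma gen_comm u v : adj u v -> commute (gen u) (gen v).
Proof. by move=> uv; rewrite /commute -!el_cat; apply/elP/pres_rel/raag_comm. Qed.

Lemma ltr_commute a b : adj a.1 b.1 -> commute (ltr a) (ltr b).
Proof.
move=> /gen_comm; case: a b => [u e] [v e'] /= uv.
suff h : commute (gen u) (ltr (v, e')).
  by case: e; rewrite // ltr_true; apply/commute_sym/commuteV/commute_sym.
by case: e'; rewrite // ltr_true; apply/commuteV.
Qed.

Section Lift.
Variables (K : groupType) (h : G -> K).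
Hypothesis hC : forall u v, adj u v -> commute (h u) (h v).

Definition lift_ltr a : K := if a.2 then (h a.1)^-1 else h a.1.
Definition lift_word w : K := foldr (fun a (z : K) => lift_ltr a * z) 1 w.
Definition raag_lift x : K := lift_word (repr x).

Lemma lift_word_cat w1 w2 : lift_word (w1 ++ w2) = lift_word w1 * lift_word w2.
Proof. by elim: w1 => [|a w1 IH] /=; rewrite ?mul1g // IH mulgA. Qed.

Lemma lift_word_eq w1 w2 :
  pres_eq (@raag_rel G) w1 w2 -> lift_word w1 = lift_word w2.
Proof.
elim=> {w1 w2} //.
- by move=> w1 w2 w3 _ -> _ ->.
- by move=> w1 w2 w1' w2' _ E1 _ E2; rewrite !lift_word_cat E1 E2.
- by case=> v [] /=; rewrite /lift_ltr /= mulg1 ?mulVg ?mulgV.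
- by move=> _ _ [u v uv]; rewrite /= /lift_ltr /= !mulg1 hC.
Qed.

Lemma lift_el w : raag_lift (el w) = lift_word w.
Proof. by apply: lift_word_eq; apply/elP; rewrite /el reprK. Qed.

Lemma raag_liftM : {morph raag_lift : x y / x * y}.
Proof.
move=> x y; have [w1 ->] := el_surj x; have [w2 ->] := el_surj y.
by rewrite -el_cat !lift_el lift_word_cat.
Qed.

Lemma lift_gen v : raag_lift (gen v) = h v.
Proof. by rewrite lift_el /= mulg1. Qed.

End Lift.

Definition word_expsum u w : int :=
  (\sum_(a <- w | a.1 == u) (if a.2 then - 1 else 1))%R.
Definition expsum u x : int := word_expsum u (repr x).

Lemma word_expsum_cat u w1 w2 :
  word_expsum u (w1 ++ w2) = (word_expsum u w1 + word_expsum u w2)%R.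
Proof. by rewrite /word_expsum big_cat. Qed.

Lemma expsum_el u w : expsum u (el w) = word_expsum u w.
Proof.
have : pres_eq (@raag_rel G) (repr (el w)) w by apply/elP; rewrite /el reprK.
rewrite /expsum; move: (repr (el w)) => w0; elim=> {w0 w} //.
- by move=> w1 w2 w3 _ -> _ ->.
- by move=> w1 w2 w1' w2' _ E1 _ E2; rewrite !word_expsum_cat E1 E2.
- by case=> v [] /=; rewrite /word_expsum !big_cons big_nil /=; case: eqP.
- move=> _ _ [v v' _]; rewrite /word_expsum !big_cons big_nil /=.
  by case: eqP => _; case: eqP => _.
Qed.

Lemma expsumM u x y : expsum u (x * y) = (expsum u x + expsum u y)%R.
Proof.
have [w1 ->] := el_surj x; have [w2 ->] := el_surj y.
by rewrite -el_cat !expsum_el word_expsum_cat.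
Qed.

Lemma expsum1 u : expsum u 1 = 0%R.
Proof. by rewrite -el_nil expsum_el /word_expsum big_nil. Qed.

Lemma expsumV u x : expsum u x^-1 = (- expsum u x)%R.
Proof. by have := expsumM u x x^-1; rewrite mulgV expsum1; lia. Qed.

Lemma expsumJ u x y : expsum u (x ^ y) = expsum u x.
Proof. by rewrite conjgE !expsumM expsumV; lia. Qed.

Lemma expsumR u x y : expsum u [~ x, y] = 0%R.
Proof. by rewrite commgEl expsumM expsumJ expsumV; lia. Qed.

Lemma expsumX u x n : expsum u (x ^+ n) = (n%:Z * expsum u x)%R.
Proof. by elim: n => [|n IH]; [rewrite expg0 expsum1|rewrite expgS expsumM IH]; lia. Qed.

Lemma expsum_zpow u x k : expsum u (zpow x k) = (k * expsum u x)%R.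
Proof. by case: k => n; rewrite /zpow ?expsumV expsumX ?NegzE; lia. Qed.

Lemma expsum_ltr u a :
  expsum u (ltr a) = (if a.1 == u then if a.2 then - 1 else 1 else 0)%R.
Proof. by rewrite expsum_el /word_expsum big_cons big_nil; case: eqP => _; case: a.2. Qed.

Lemma expsum_gen u v : expsum u (gen v) = ((v == u)%:Z)%R.
Proof. by rewrite expsum_ltr /=; case: eqP. Qed.

(** The standard parabolic subgroup on T, as a predicate. *)
Definition in_std (T : pred G) x : Prop := exists2 w, all (fun a => T a.1) w & x = el w.

Lemma in_std1 T : in_std T 1. Proof. by exists [::]. Qed.

Lemma in_stdM T x y : in_std T x -> in_std T y -> in_std T (x * y).
Proof.
by move=> [w1 h1 ->] [w2 h2 ->]; exists (w1 ++ w2); rewrite ?el_cat ?all_cat ?h1.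
Qed.

Lemma in_stdV T x : in_std T x -> in_std T x^-1.
Proof.
move=> [w h ->]; exists (word_inv w); last by rewrite el_inv.
by rewrite /word_inv all_rev all_map.
Qed.

Lemma in_stdR T x y : in_std T x -> in_std T y -> in_std T [~ x, y].
Proof.
move=> hx hy; rewrite commgEl conjgE.
by do ![apply: in_stdM|apply: in_stdV] => //; apply: in_stdM.
Qed.

Lemma in_stdX T x n : in_std T x -> in_std T (x ^+ n).
Proof.
by move=> h; elim: n => [|n IH]; rewrite ?expgS; [apply: in_std1|apply: in_stdM].
Qed.

Lemma in_std_zpow T x k : in_std T x -> in_std T (zpow x k).
Proof. by case: k => n h; [apply: in_stdX|apply/in_stdV/in_stdX]. Qed.

Lemma in_std_ltr (T : pred G) a : T a.1 -> in_std T (ltr a).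
Proof. by move=> h; exists [:: a] => //=; rewrite h. Qed.

Lemma in_std_sub (T T' : pred G) x : subpred T T' -> in_std T x -> in_std T' x.
Proof. by move=> h [w hw ->]; exists w => //; apply: sub_all hw => a /h. Qed.

Lemma in_std_expsum (T : pred G) x u : in_std T x -> ~~ T u -> expsum u x = 0%R.
Proof.
move=> [w /allP h ->] Tu; rewrite expsum_el /word_expsum big1_seq // => a /andP[/eqP E /h].
by rewrite E (negPf Tu).
Qed.

Lemma in_std_commute (T : pred G) x y :
  (forall b, T b.1 -> commute x (ltr b)) -> in_std T y -> commute x y.
Proof.
move=> h [w hw ->]; elim: w hw => [_|b w IH] /=; first exact: commute1.
by move=> /andP[/h hb /IH hw]; rewrite el_cons; apply: commuteM.
Qed.

End Raag.

(** * Walls in the Cayley graph *)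

Section Walls.
Variable G : sgraph.
Local Notation A := (raag G).
Local Notation letter := (G * bool)%type.
Implicit Types (a b : letter) (w : word G) (x y s : A) (u v : G).

Local Notation inL a := (in_std (adj a.1)).

Lemma inL_commute a s : inL a s -> commute (ltr a) s.
Proof. by apply: in_std_commute => b; apply: ltr_commute. Qed.

(** The wall of a letter [a] is the set of edges [s -- s a] of the Cayley graph
    with [s] in the subgroup L(a) generated by the link of [a.1]. It is the wall
    of the universal cover of the Salvetti complex dual to the edge [1 -- a]. The
    two disjuncts are the two directions in which the edge [x -- x b] can run. *)
Definition crosses a x b : bool :=
  (b == a) && `[< inL a x >] || (b == flip a) && `[< inL a (x * ltr b) >].

Fixpoint crossings a x w : bool :=
  if w is b :: w' then crosses a x b (+) crossings a (x * ltr b) w' else false.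

(** The parity of the number of times that a path from 1 to [x] meets the wall
    of [a]. The parity does not depend on the path, so the wall separates the
    Cayley graph, and [side a x] says that [x] lies beyond it. *)
Definition side a x : bool := crossings a 1 (repr x).

Lemma crossings_cat a x w1 w2 :
  crossings a x (w1 ++ w2) = crossings a x w1 (+) crossings a (x * el w1) w2.
Proof.
elim: w1 x => [|b w1 IH] x /=; first by rewrite mulg1.
by rewrite IH el_cons mulgA addbA.
Qed.

Lemma in_std_mulr (T : pred G) x s : in_std T s -> in_std T (x * s) <-> in_std T x.
Proof.
move=> Ts; split=> [Txs|Tx]; last exact: in_stdM.
by rewrite -[x](mulgK s); apply: in_stdM => //; apply: in_stdV.
Qed.

Lemma in_std_mull (T : pred G) x s : in_std T s -> in_std T (s * x) <-> in_std T x.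
Proof.
move=> Ts; split=> [Tsx|Tx]; last exact: in_stdM.
by rewrite -[x](mulKg s); apply: in_stdM => //; apply: in_stdV.
Qed.

(** Only the commutation relations need an argument: the opposite edges of a
    square lie in the same walls, because two adjacent vertices that span the
    square have each other in their links. *)
Lemma crossings_eq a x w1 w2 :
  pres_eq (@raag_rel G) w1 w2 -> crossings a x w1 = crossings a x w2.
Proof.
move=> h; elim: h x => {w1 w2} //.
- by move=> w1 w2 w3 _ E1 _ E2 x; rewrite E1 E2.
- move=> w1 w2 w1' w2' /elP E IH1 _ IH2 x.
  rewrite -[LHS]/(crossings a x (w1 ++ w2)) -[RHS]/(crossings a x (w1' ++ w2')).
  by rewrite !crossings_cat IH1 IH2 E.
- move=> b x /=; rewrite addbF; suff -> : crosses a x b = crosses a (x * ltr b) (flip b).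
    exact: addbb.
  by rewrite /crosses !(can2_eq (@flipK G) (@flipK G)) flipK ltr_flip mulgK orbC.
- move=> _ _ [u v uv] x /=; rewrite !addbF.
  have side_eq p q y : adj p q ->
      crosses a y (p, false) = crosses a (y * ltr (q, false)) (p, false).
    move=> pq; have C : commute (gen p) (gen q) := gen_comm pq.
    have M y' : adj a.1 q -> `[< inL a y' >] = `[< inL a (y' * gen q) >].
      move=> aq; apply/asboolP/asboolP => h.
        by apply/in_std_mulr => //; apply: in_std_ltr.
      by apply/(in_std_mulr _ (in_std_ltr (a := (q, false)) aq)).
    rewrite /crosses; congr (_ || _); case: eqP => //= E.
      by rewrite [ltr (q, _)]/(gen q) -M // -E.
    rewrite -mulgA -[ltr (q, _) * _]C mulgA -M //.
    by rewrite -[a]flipK -E.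
  by rewrite -(side_eq u v) // -(side_eq v u) 1?adj_sym // addbC.
Qed.

Lemma side_el a w : side a (el w) = crossings a 1 w.
Proof. by apply: crossings_eq; apply/elP; rewrite /el reprK. Qed.

Lemma sideM a x b : side a (x * ltr b) = side a x (+) crosses a x b.
Proof.
have [w ->] := el_surj x; rewrite -el_rcons !side_el -cats1 crossings_cat /=.
by rewrite mul1g addbF.
Qed.

Lemma side1 a : side a 1 = false.
Proof. by rewrite -el_nil side_el. Qed.

Lemma crosses_off a x b : b.1 != a.1 -> crosses a x b = false.
Proof.
move=> h; rewrite /crosses.
have /negPf -> : b != a by apply: contra h => /eqP ->.
by have /negPf -> : b != flip a by apply: contra h => /eqP ->.
Qed.

(** The wall of [a] is met along edges labelled [a.1] only, so a path that avoids
    this label stays on one side. *)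
Lemma side_off (T : pred G) a x s : in_std T s -> ~~ T a.1 -> side a (x * s) = side a x.
Proof.
move=> [w hw ->] Ta; elim: w hw x => [_ x|b w IH] /=; first by rewrite el_nil mulg1.
move=> /andP[Tb hw] x; rewrite el_cons mulgA IH // sideM crosses_off ?addbF //.
by apply: contra Ta => /eqP <-.
Qed.

Lemma side_L a s : inL a s -> side a s = false.
Proof.
by move=> h; rewrite -[s]mul1g (side_off _ h) ?side1 //= adj_irrefl.
Qed.

(** The wall is crossed away from 1 only through an edge [s -- s a] with [s] in
    L(a), because all of L(a) lies on the side of 1. *)
Lemma cross_up a x b : ~~ side a x -> side a (x * ltr b) -> b = a /\ inL a x.
Proof.
move=> /negPf h h'; move: (h'); rewrite sideM h /= => /orP[] /andP[/eqP E /asboolP Lx] //.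
by rewrite (side_L Lx) in h'.
Qed.

Lemma cross_down a x b :
  side a x -> ~~ side a (x * ltr b) -> b = flip a /\ inL a (x * ltr b).
Proof.
move=> h; rewrite sideM h negbK => /orP[] /andP[/eqP E /asboolP Lx] //.
by rewrite (side_L Lx) in h.
Qed.

Lemma crosses_mull a s x b : inL a s -> crosses a (s * x) b = crosses a x b.
Proof.
move=> Ls; have E y : `[< inL a (s * y) >] = `[< inL a y >].
  by apply/asboolP/asboolP => /(in_std_mull _ Ls).
by rewrite /crosses -mulgA !E.
Qed.

(** L(a) stabilizes the wall of [a] together with its two sides. *)
Lemma side_mull a s x : inL a s -> side a (s * x) = side a x.
Proof.
move=> Ls; elim/raag_indr: x => [|x b IH]; first by rewrite mulg1 side1 side_L.
by rewrite mulgA !sideM IH crosses_mull.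
Qed.

Lemma side_mulr a s x : inL a s -> side a (x * s) = side a x.
Proof. by move=> h; rewrite (side_off _ h) //= adj_irrefl. Qed.

Lemma side_ltr a : side a (ltr a).
Proof.
rewrite -[ltr a]mul1g sideM side1 /crosses eqxx /=.
by rewrite (_ : `[< _ >]) //; apply/asboolP/in_std1.
Qed.

(** The walls of [a] and of its inverse are translates of each other by [a]; both
    sides of the equation change along the same edges and agree at 1. *)
Lemma side_ltrM a x : side a (ltr a * x) = ~~ side (flip a) x.
Proof.
have swap b y : inL a (ltr a * y) <-> inL a (y * ltr a).
  split=> [h|h].
    have := inL_commute h; rewrite /commute -[RHS]mulgA => /mulgI <-.
    exact: h.
  have := inL_commute h; rewrite /commute mulgA => /mulIg; move=> ->.
  exact: h.
elim/raag_indr: x => [|x b IH]; first by rewrite mulg1 side_ltr side1.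
rewrite mulgA !sideM IH addNb; congr (~~ (_ (+) _)).
rewrite /crosses flipK orbC; congr (_ || _); last first.
  case: eqP => //= ->; apply/asboolP/asboolP => [/swap h|h]; first exact/h.
  exact/(swap a).
case: eqP => //= ->; rewrite ltr_flip; apply/asboolP/asboolP.
  by rewrite -mulgA => /(swap a); rewrite mulgVK.
by rewrite -mulgA => h; apply/(swap a); rewrite mulgVK.
Qed.

Lemma ltr_notinL a x : inL a x -> inL a (x * ltr a) -> False.
Proof.
move=> Lx /(in_std_mull (ltr a) Lx) h.
by have := side_L h; rewrite side_ltr.
Qed.

Lemma walk (P : pred A) x w :
  P x -> ~~ P (x * el w) ->
  exists w1 b w2, [/\ w = w1 ++ b :: w2, P (x * el w1) & ~~ P (x * el w1 * ltr b)].
Proof.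
elim: w x => [|b w IH] x Px; first by rewrite el_nil mulg1 Px.
rewrite el_cons mulgA; case h : (P (x * ltr b)).
  move=> /(IH _ h) [w1 [b' [w2 [-> h1 h2]]]]; exists (b :: w1), b', w2.
  by rewrite el_cons !mulgA.
by move=> _; exists [::], b, w; rewrite el_nil mulg1 h.
Qed.

Lemma walk_el (P : pred A) x y :
  P x -> ~~ P y -> exists z b, P z /\ ~~ P (z * ltr b).
Proof.
move=> Px; have [w E] := el_surj (x^-1 * y); rewrite -[y](mulVKg x) E.
by move=> /(walk Px) [w1 [b [_ [_ h1 h2]]]]; exists (x * el w1), b.
Qed.

(** The half-space beyond the wall of [a] is mapped into itself by [a]. Otherwise
    a path from an offending point to 1 leaves the set of offending points. It
    does so across the wall of [a] or across its translate, and on both walls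
    the points next to the wall are not offending. *)
Lemma side_ltr_mono a x : side a x -> side a (ltr a * x).
Proof.
have n1 y : inL a y -> side a (y * ltr a) by move=> h; rewrite side_mull ?side_ltr.
move=> ax; apply/negPn/negP => nax.
have [||z [b [/andP[az naz]]]] :=
    @walk_el (fun z => side a z && ~~ side a (ltr a * z)) x 1.
- by rewrite ax.
- by rewrite side1.
rewrite negb_and negbK => /orP[zb|zb].
  have [Eb Lz] := cross_down az zb.
  move/negP: naz; apply; have -> : ltr a * z = z * ltr b * (ltr a * ltr a).
    have Ez : z = z * ltr b * ltr a by rewrite Eb ltr_flip mulgVK.
    by rewrite {1}Ez mulgA (inL_commute Lz) !mulgA.
  rewrite side_mull // sideM side_ltr /crosses eqxx /= eq_sym flip_neq orbF.
  by apply/asboolP => h; have := side_L h; rewrite side_ltr.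
rewrite mulgA in zb; have [Eb Lz] := cross_up naz zb.
move: az; rewrite -[z](mulKg (ltr a)) -ltr_flip.
have -> : ltr (flip a) * (ltr a * z) = ltr a * z * ltr (flip a).
  by rewrite ltr_flip; apply/commute_sym/commuteV/commute_sym/inL_commute.
rewrite side_mull // -[ltr _]mul1g sideM side1 /crosses flip_neq eqxx mul1g /= => /asboolP h.
apply: (@ltr_notinL a 1); first exact: in_std1.
by rewrite mul1g -[ltr a]invgK -ltr_flip; apply: in_stdV.
Qed.

Lemma side_disjoint a x : side a x -> ~~ side (flip a) x.
Proof. by rewrite -side_ltrM => /side_ltr_mono. Qed.

End Walls.

(** * Elements that skewer a wall and their centralizers *)

Section Skewers.
Variable G : sgraph.
Local Notation A := (raag G).
Local Notation letter := (G * bool)%type.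
Implicit Types (a b : letter) (w : word G) (x y s g h : A) (u v : G) (j k : int).
Local Notation inL a := (in_std (adj a.1)).

Lemma wlen_ex x : exists n, `[< exists2 w, size w = n & x = el w >].
Proof. by have [w ->] := el_surj x; exists (size w); apply/asboolP; exists w. Qed.

Definition wlen x : nat := ex_minn (wlen_ex x).

Lemma geodesic x : exists2 w, size w = wlen x & x = el w.
Proof. by rewrite /wlen; case: ex_minnP => n /asboolP. Qed.

Lemma wlen_el w : wlen (el w) <= size w.
Proof.
by rewrite /wlen; case: ex_minnP => n _; apply; apply/asboolP; exists w.
Qed.

Lemma wlenV_le x : wlen x^-1 <= wlen x.
Proof.
have [w <- ->] := geodesic x; rewrite -el_inv.
by apply: leq_trans (wlen_el _) _; rewrite size_rev size_map.
Qed.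

Lemma wlenV x : wlen x^-1 = wlen x.
Proof. by apply/eqP; rewrite eqn_leq wlenV_le -{1}[x]invgK wlenV_le. Qed.

(** [g] skewers the wall of [a]: it translates the half-space beyond the wall
    properly into itself, so the translates of the wall by the powers of [g] are
    linearly nested. *)
Definition skewers a g := side a g /\ forall x, side a x -> side a (g * x).

Lemma skewers_ltr a : skewers a (ltr a).
Proof. by split; [apply: side_ltr|move=> x; apply: side_ltr_mono]. Qed.

Lemma skewersX a g n x : skewers a g -> side a x -> side a (g ^+ n * x).
Proof.
move=> [_ gm] ax; elim: n => [|n IH]; first by rewrite mul1g.
by rewrite expgS -mulgA gm.
Qed.

Lemma skewers_pow a g j : skewers a g -> side a (zpow g j) = (0 < j)%R.
Proof.
move=> sk; case: j => [[|n]|n].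
- by rewrite zpow0 side1.
- by rewrite /= expgSr; apply: skewersX sk.1.
apply/negbTE/negP => /= h; have := skewersX n.+1 sk h.
by rewrite mulgV side1.
Qed.

Lemma skewers_notL a g j : skewers a g -> inL a (zpow g j) -> j = 0%R.
Proof.
move=> sk h; have h1 := side_L h; have h2 := side_L (in_stdV h).
by move: h1 h2; rewrite -zpowN !skewers_pow //; lia.
Qed.

(** A path from 1 to [y] has finitely many edges, and each of them lies in at
    most one of the nested walls. So far out along [g], the position of [y]
    relative to these walls is that of 1. *)
Lemma skewers_fin a g y : skewers a g ->
  exists N : nat, forall j, (N <= `|j|)%N -> side a (zpow g j * y) = (0 < j)%R.
Proof.
move=> sk; elim/raag_indr: y => [|y b [N IH]].
  by exists 0 => j _; rewrite mulg1 skewers_pow.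
have one j1 j2 : crosses a (zpow g j1 * y) b -> crosses a (zpow g j2 * y) b -> j1 = j2.
  have key z : inL a (zpow g j1 * z) -> inL a (zpow g j2 * z) -> j1 = j2.
    move=> h1 h2; have := in_stdM h1 (in_stdV h2).
    rewrite invgM mulgA mulgK -zpowN -zpowD => /(skewers_notL sk); lia.
  case/orP => /andP[/eqP -> /asboolP h1] /orP[] /andP[/eqP Eb /asboolP h2].
  - exact: key h1 h2.
  - by have := flip_neq a; rewrite -Eb eqxx.
  - by have := flip_neq a; rewrite Eb eqxx.
  - by move: h1 h2; rewrite -!mulgA; apply: key.
case: (pselect (exists j0, crosses a (zpow g j0 * y) b)) => [[j0 h0]|h0].
  exists (maxn N (absz j0).+1) => j; rewrite geq_max => /andP[Nj jj].
  rewrite mulgA sideM IH //; case h : (crosses _ _ _); last by rewrite addbF.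
  by have := one _ _ h h0; lia.
exists N => j Nj; rewrite mulgA sideM IH //.
by case h : (crosses _ _ _); [case: h0; exists j|rewrite addbF].
Qed.

(** Far backwards [g ^ j * y] lies on the side of 1 and far forwards it lies
    beyond the wall, so there is a first power of [g] that carries it across. *)
Lemma skewers_switch a g y : skewers a g ->
  exists j, ~~ side a (zpow g j * y) /\ side a (zpow g (j + 1) * y).
Proof.
move=> sk; have [N hN] := skewers_fin y sk.
have ex : exists n : nat, side a (zpow g (n%:Z - N%:Z) * y).
  by exists (N + N.+1)%N; rewrite hN; lia.
case: (ex_minnP ex) => -[|n] h1 h2; first by move: h1; rewrite hN; lia.
exists (n%:Z - N%:Z)%R; split; last by rewrite (_ : _ + 1 = n.+1%:Z - N%:Z)%R //; lia.
by apply/negP => /h2; rewrite ltnn.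
Qed.

(** If [h] centralizes [g], all translates of the wall by the powers of [h] lie
    on the axis of [g]. Up to translation by [g] they meet a fixed path from 1
    to [g], which has finitely many edges. By the pigeonhole principle a product
    of a positive power of [h] and a power of [g] stabilizes the wall. *)
Lemma skewers_centralizer a g h : skewers a g -> commute h g ->
  exists r : nat, (0 < r)%N /\ exists k, inL a (h ^+ r * zpow g k).
Proof.
move=> sk hg; have [w Ew] := el_surj g.
have cross (i : 'I_(size w).+1) : exists p : 'I_(size w),
    exists j, inL a (zpow g j * h ^+ i * el (take p w)).
  have [j [h1 h2]] := skewers_switch (h ^+ i) sk.
  have h3 : side a (zpow g j * h ^+ i * el w).
    rewrite -Ew -mulgA (_ : h ^+ i * g = g * h ^+ i); last first.
      by apply/commute_sym/commuteX/commute_sym.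
    by rewrite mulgA -zpowS.
  have [||w1 [b [w2 [E n1]]]] :=
      @walk G (fun x => ~~ side a x) (zpow g j * h ^+ i) w; rewrite ?negbK //.
  case/(cross_up n1) => Eb L.
  have lt : size w1 < size w by rewrite E size_cat /=; lia.
  have Et : take (size w1) w = w1 by rewrite E take_size_cat.
  by exists (Ordinal lt), j; rewrite /= Et.
have [p hp] := choice cross.
have [i1 [i2 [i12 E]]] : exists i1 i2 : 'I_(size w).+1, (i1 < i2)%N /\ p i1 = p i2.
  have /injectivePn[i1 [i2 ne E]] : ~~ injectiveb p.
    by apply/negP => /injectiveP /leq_card; rewrite !card_ord ltnn.
  move: ne; rewrite neq_ltn => /orP[lt|lt]; first by exists i1, i2.
  by exists i2, i1.
have [j1 h1] := hp i1; have [j2 h2] := hp i2; rewrite -E in h2.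
exists (i2 - i1)%N; split; first by rewrite subn_gt0.
exists (j2 - j1)%R; have := in_stdM h2 (in_stdV h1).
rewrite !invgM !mulgA mulgK expgnFr; last exact: ltnW.
rewrite zpowD zpowN mulgA.
suff -> : zpow g j2 * h ^+ i2 / h ^+ i1 = h ^+ i2 / h ^+ i1 * zpow g j2 by [].
rewrite -mulgA; apply/commute_sym/commute_zpow/commute_sym.
by apply: commuteM; [|apply: commuteV]; apply/commuteX/commute_sym.
Qed.

(** For a single letter the path of the pigeonhole argument has one edge. *)
Lemma centralizer_ltr a y : commute y (ltr a) -> exists j, inL a (zpow (ltr a) j * y).
Proof.
move=> ya; have [j [h1]] := skewers_switch y (skewers_ltr a).
by rewrite zpowS -mulgA -ya mulgA => /(cross_up h1)[_ h]; exists j.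
Qed.

(** An element of minimal length in its conjugacy class skewers the wall of each
    first letter of a geodesic word for it: any failure shows a cancellation in
    the word, or between its two ends. *)
Lemma geodesic_skew a w : let g := el (a :: w) in
  (forall y, (size w < wlen (g ^ y))%N) -> skewers a g.
Proof.
move=> g gmin.
have geo w' : el w' = g -> (size w < size w')%N.
  by move=> E; apply: leq_trans (wlen_el w'); rewrite E -[g]conjg1.
(* Recrossing the wall of [a] would cancel the first letter of a geodesic. *)
have ag : side a g.
  apply/negPn/negP; rewrite /g el_cons => h.
  have [w1 [b [w2 [E h1 h2]]]] := walk (side_ltr a) h.
  have [Eb L] := cross_down h1 h2.
  have E1 : ltr a * el w1 * ltr b = el w1.
    apply: (mulgI (ltr a)); rewrite (inL_commute L) Eb ltr_flip.
    by rewrite mulgVK.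
  have : (size w < size (w1 ++ w2))%N.
    by apply: geo; rewrite el_cat -E1 /g E el_cons el_cat el_cons !mulgA.
  by rewrite E !size_cat /=; lia.
(* A geodesic for [g^-1] ends with the inverse of [a]; if one also began with [a],
   conjugating by [a] would shorten [g]. *)
have agV : ~~ side a g^-1.
  apply/negP => h; have Eg : g^-1 = el (word_inv w) * ltr (flip a).
    by rewrite /g el_cons invgM el_inv ltr_flip.
  have : side a (el (word_inv w)).
    apply/negPn/negP => h1; move: h; rewrite Eg => /(cross_up h1) [E _].
    by have := flip_neq a; rewrite E eqxx.
  rewrite -[el _]mul1g => h1.
  have [||w1 [b [w2 [E n1 n2]]]] := @walk G (fun x => ~~ side a x) 1 (word_inv w).
  - by rewrite side1.
  - by rewrite negbK.
  rewrite negbK mul1g in n2; rewrite mul1g in n1; have [Eb L] := cross_up n1 n2.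
  have : (size w < wlen (g ^ (ltr a)))%N := gmin _.
  have -> : g ^ ltr a = (el (w1 ++ w2))^-1.
    apply: invg_inj; rewrite -conjVg invgK Eg E Eb el_cat el_cons conjgE ltr_flip.
    by rewrite mulgVK [el w1 * _]mulgA -(inL_commute L) -mulgA mulKg el_cat.
  rewrite wlenV ltnNge (leq_trans (wlen_el _)) //.
  have <- : size (word_inv w) = size w by rewrite size_rev size_map.
  by rewrite E !size_cat /=; lia.
split=> // x ax; apply/negPn/negP => ngx.
have [||z [b [/andP[az ngz]]]] :=
    @walk_el G (fun z => side a z && ~~ side a (g * z)) x 1.
- by rewrite ax.
- by rewrite side1.
rewrite negb_and negbK => /orP[zb|zb].
  have [Eb L] := cross_down az zb.
  have n1 : side a (g * (z * ltr b)) by rewrite side_mulr.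
  have Ez : g * z = g * (z * ltr b) * ltr a by rewrite Eb ltr_flip -mulgA mulgVK.
  rewrite Ez in ngz; have [E _] := cross_down n1 ngz.
  by have := flip_neq a; rewrite -E eqxx.
rewrite mulgA in zb; have [Eb L] := cross_up ngz zb.
by move: az; rewrite -[z](mulKg g) side_mulr // (negPf agV).
Qed.

End Skewers.

(** * Images of generators under automorphisms *)

Lemma morph1 (T U : groupType) (f : T -> U) : {morph f : x y / x * y} -> f 1 = 1.
Proof. by move=> fM; apply: (mulgI (f 1)); rewrite -fM !mulg1. Qed.

HB.instance Definition _ (T : groupType) (f : aut T) :=
  isMultiplicative.Build T T (aut_fun f) (@autM T f).
HB.instance Definition _ (T : groupType) (f : aut T) :=
  Multiplicative_isUMagmaMorphism.Build T T (aut_fun f) (morph1 (@autM T f)).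

Section AutMorphism.
Variables (T : groupType) (f : aut T).

Lemma aut1 : f 1 = 1. Proof. exact: gmulf1. Qed.
Lemma autV x : f x^-1 = (f x)^-1. Proof. exact: gmulfV. Qed.
Lemma autX x n : f (x ^+ n) = f x ^+ n. Proof. exact: gmulfXn. Qed.
Lemma autJ x y : f (x ^ y) = f x ^ f y. Proof. exact: gmulfJ. Qed.
Lemma autR x y : f [~ x, y] = [~ f x, f y]. Proof. exact: gmulfR. Qed.
Lemma aut_zpow x k : f (zpow x k) = zpow (f x) k.
Proof. by case: k => n; rewrite /zpow ?autV autX. Qed.
Lemma aut_commute x y : commute x y -> commute (f x) (f y).
Proof. exact: gmulf_commute. Qed.

End AutMorphism.

Section Cyclic.
Variable G : sgraph.
Local Notation A := (raag G).
Local Notation letter := (G * bool)%type.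
Implicit Types (a b : letter) (w : word G) (x y z s t g h : A) (u v : G) (j k : int).
Local Notation inL a := (in_std (adj a.1)).

(** If [t] avoids [a.1] then so does every path along the orbit of its powers,
    and this orbit stays on one side of each wall labelled [a.1]. *)
Lemma skewers_in_std (T : pred G) a t z : skewers a (t ^ z) -> in_std T t -> T a.1.
Proof.
move=> sk Tt; apply/negPn/negP => nT.
have [j []] := skewers_switch z^-1 sk.
have E i : zpow (t ^ z) i * z^-1 = z^-1 * zpow t i.
  by rewrite zpowJ conjgE !mulgA mulgK.
by rewrite !E !(side_off _ (in_std_zpow _ Tt) nT) => /negP.
Qed.

(** In a shortest word up to conjugacy every letter can be rotated to the front,
    so its wall is skewered by a conjugate of the given element. *)
Lemma cyclic_word x :
  exists w y, x = el w ^ y /\ forall a, a \in w -> exists z, skewers a (x ^ z).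
Proof.
have ex : exists n, `[< exists y, wlen (x ^ y) = n >].
  by exists (wlen (x ^ 1)); apply/asboolP; exists 1.
case: (ex_minnP ex) => n /asboolP[y yn] nmin.
have [w sw Ew] := geodesic (x ^ y).
exists w, y^-1; split; first by rewrite -Ew conjgK.
move=> a /path.splitPr spl; case: spl sw Ew => w1 w2 sw Ew.
have Eg : el (a :: w2 ++ w1) = x ^ (y * el w1).
  rewrite conjgM Ew conjgE !el_cat !el_cons !el_cat.
  by rewrite -!mulgA mulKg.
exists (y * el w1); rewrite -Eg; apply: geodesic_skew => z.
rewrite Eg -conjgM; have : n <= wlen (x ^ (y * el w1 * z)).
  by apply: nmin; apply/asboolP; exists (y * el w1 * z).
by apply: leq_trans; rewrite -yn -sw !size_cat /=; lia.
Qed.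

Lemma el_one_vertex u w :
  all (fun a => a.1 == u) w -> el w = zpow (gen u) (expsum u (el w)).
Proof.
elim: w => [|[v e] w IH] /=; first by rewrite el_nil expsum1.
move=> /andP[/eqP -> /IH E]; rewrite el_cons expsumM expsum_ltr eqxx zpowD /= -E.
by case: e => //=; rewrite ltr_true expg1.
Qed.

End Cyclic.

Lemma commg_central (T : groupType) (x y c d : T) :
  commute c x -> commute c y -> commute d x -> commute d y -> commute c d ->
  [~ x * c, y * d] = [~ x, y].
Proof.
move=> cx cy dx dy cd; apply: (mulgI (y * x)).
apply: (mulIg (c * d)).
have E1 : y * x * [~ x, y] = x * y by rewrite /commg conjgE !mulgA mulgK mulgV mul1g.
have cdC : (c * d) * [~ x * c, y * d] = [~ x * c, y * d] * (c * d).
  have Z z : commute z x -> commute z y -> commute z c -> commute z d ->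
      commute z [~ x * c, y * d].
    by move=> *; rewrite /commg conjgE; do ?[apply: commuteM | apply: commuteV].
  by apply: commute_sym; apply: commuteM; apply/commute_sym/Z => //; apply/commute_sym.
have E2 : y * x * [~ x * c, y * d] * (c * d) = x * c * (y * d).
  rewrite -[LHS]mulgA -cdC mulgA; have -> : y * x * (c * d) = y * d * (x * c).
    by rewrite -!mulgA; congr (y * _); rewrite cd !mulgA dx.
  by rewrite /commg conjgE -[LHS]mulgA !mulVKg.
by rewrite E1 E2 -!mulgA; congr (x * _); rewrite !mulgA cy.
Qed.

Section AutGen.
Variable G : sgraph.
Local Notation A := (raag G).
Local Notation letter := (G * bool)%type.
Implicit Types (a b : letter) (w : word G) (x y s t g h : A) (u v : G) (j k : int).
Local Notation inL a := (in_std (adj a.1)).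

(** A commuting power of [gen v] would give an element of the subgroup of the link
    of [u] with nonzero exponent sum at [v]. *)
Lemma gen_pow_ncomm u v m n : u <> v -> ~~ adj u v -> (0 < m)%N -> (0 < n)%N ->
  ~ commute (gen u ^+ m) (gen v ^+ n).
Proof.
move=> uv nuv m0 n0 C.
have sk : skewers (u, false) (gen u ^+ m).
  have sk1 := skewers_ltr (u, false).
  split; last by move=> x; apply: skewersX.
  by rewrite -(zpow_nat (gen u)) skewers_pow.
have [r [r0 [k /in_std_expsum /(_ nuv)]]] := skewers_centralizer sk (commute_sym C).
rewrite expsumM expsum_zpow !expsumX !expsum_gen eqxx (negPf (introN eqP uv)); nia.
Qed.

Hypothesis tri : forall u v w : G, adj u v -> adj v w -> adj u w -> False.
Hypothesis sq : forall u u' t t' : G, u <> u' ->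
  adj u t -> adj u' t -> adj u t' -> adj u' t' -> t = t'.
Hypothesis deg2 : forall v : G, exists w1 w2 : G, [/\ w1 <> w2, adj v w1 & adj v w2].

(** An automorphism maps each generator [v] to a conjugate of a generator or of
    its inverse. Suppose that the shortest cyclic word of the image contains two
    vertices [u <> u']. For neighbours [w1], [w2] of [v], [skewers_centralizer]
    gives images of products of powers of [w_i] and [v] in conjugates of the
    subgroups of lk u and of lk u'. As [v] commutes with [w1] and [w2], a suitable
    commutator [e] of powers of [w1] and [w2] has its image in both conjugates.
    There are no squares, so lk u and lk u' share at most one vertex [t], and the
    image of [e] is conjugate to a power of [t]. Commutators have zero exponent
    sums, so [e = 1], and this contradicts [gen_pow_ncomm]. Hence the image is
    conjugate to a power of one generator, and applying the inverse automorphism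
    shows that the exponent is 1 or -1. *)
Lemma aut_gen (f : aut A) v : exists a y, f (gen v) = ltr a ^ y.
Proof.
have [w1 [w2 [w12 vw1 vw2]]] := deg2 v.
have [w [y [E sk]]] := cyclic_word (f (gen v)).
have cent a u : a \in w -> adj v u -> forall z, skewers a (f (gen v) ^ z) ->
    exists r : nat, (0 < r)%N /\
    exists k, inL a (f (gen u ^+ r * zpow (gen v) k) ^ z).
  move=> aw vu z skz.
  have C : commute (f (gen u) ^ z) (f (gen v) ^ z).
    by apply/commuteJ/aut_commute/gen_comm; rewrite adj_sym.
  have [r [r0 [k h]]] := skewers_centralizer skz C.
  exists r; split=> //; exists k.
  by rewrite autM aut_zpow autX conjMg conjXg -zpowJ.
have same a b : a \in w -> b \in w -> a.1 = b.1.
  move=> aw bw; have [z za] := sk _ aw; have [z' zb] := sk _ bw.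
  apply: contrapT => nab.
  have [r1 [r10 [k1 h1]]] := cent _ _ aw vw1 _ za.
  have [r2 [r20 [k2 h2]]] := cent _ _ aw vw2 _ za.
  have [s1 [s10 [l1 g1]]] := cent _ _ bw vw1 _ zb.
  have [s2 [s20 [l2 g2]]] := cent _ _ bw vw2 _ zb.
  (* The exponents are common multiples of those obtained for the two walls. *)
  pose e := [~ gen w1 ^+ (r1 * s1), gen w2 ^+ (r2 * s2)].
  have eE p1 p2 q1 q2 m1 m2 : (p1 * q1 = r1 * s1)%N -> (p2 * q2 = r2 * s2)%N ->
      e = [~ (gen w1 ^+ p1 * zpow (gen v) m1) ^+ q1,
             (gen w2 ^+ p2 * zpow (gen v) m2) ^+ q2].
    move=> E1 E2.
    have cv u : adj v u -> forall p m, commute (zpow (gen v) m) (gen u ^+ p).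
      by move=> vu p m; apply/commuteX/commute_sym/commute_zpow/gen_comm; rewrite adj_sym.
    rewrite !expgMn; [|by apply/commute_sym/cv..].
    rewrite -!expgnA E1 E2 commg_central //; try by apply/commute_sym/commuteX/commute_sym/cv.
    by apply: commuteX2; apply: commute_zpow; apply/commute_sym/commute_zpow.
  have ea : inL a (f e ^ z).
    rewrite (eE r1 r2 s1 s2 k1 k2) //.
    by rewrite autR conjRg !autX !conjXg; apply: in_stdR; apply: in_stdX.
  have eb : inL b (f e ^ z').
    rewrite (eE s1 s2 r1 r2 l1 l2) 1?mulnC // 1?mulnC //.
    by rewrite autR conjRg !autX !conjXg; apply: in_stdR; apply: in_stdX.
  (* Every letter of a shortest cyclic word of [f e] lies in both links. *)
  have e1 : f e = 1.
    have [w0 [y0 [E0 sk0]]] := cyclic_word (f e).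
    have both c : c \in w0 -> adj a.1 c.1 /\ adj b.1 c.1.
      case/sk0 => z0 skc; split.
        by apply: (skewers_in_std (z := z^-1 * z0)) ea; rewrite -conjgM mulVKg.
      by apply: (skewers_in_std (z := z'^-1 * z0)) eb; rewrite -conjgM mulVKg.
    case: w0 E0 sk0 both => [|c w0] E0 _ both; first by rewrite E0 el_nil conj1g.
    rewrite E0 (@el_one_vertex G c.1); last first.
      apply/allP => c' /both[ac' bc']; apply/eqP.
      have [ac bc] := both c (mem_head _ _).
      exact: (sq nab ac' bc' ac bc).
    by rewrite -(expsumJ c.1 _ y0) -E0 autR expsumR zpow0 conj1g.
  have {}e1 : e = 1 by apply: (can_inj (aut_invK f)); rewrite e1 aut1.
  apply: (@gen_pow_ncomm w1 w2 (r1 * s1) (r2 * s2)) => //.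
  - by apply/negP => /(tri vw1) /(_ vw2).
  - by rewrite muln_gt0 r10.
  - by rewrite muln_gt0 r20.
  - by apply/commgP/eqP.
case: w E sk cent same => [|c w] E _ _ same.
  have : expsum v (aut_inv f (f (gen v))) = 1%R by rewrite aut_invK expsum_gen eqxx.
  by rewrite E el_nil conj1g aut1 expsum1.
have Ew : el (c :: w) = zpow (gen c.1) (expsum c.1 (el (c :: w))).
  by apply: el_one_vertex; apply/allP => c' c'w; apply/eqP/same; rewrite ?mem_head.
rewrite Ew in E; move: (expsum _ _) E => m E.
have : expsum v (aut_inv f (f (gen v))) = 1%R by rewrite aut_invK expsum_gen eqxx.
rewrite E autJ expsumJ aut_zpow expsum_zpow => m1.
have [M|M] : (m = 1 \/ m = - 1)%R.
  move/(congr1 absz)/eqP: m1; rewrite abszM muln_eq1 => /andP[/eqP m1 _]; lia.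
  by exists (c.1, false), y; rewrite M.
by exists (c.1, true), y; rewrite M ltr_true zpowN.
Qed.

End AutGen.

(** * Commuting conjugates of generators *)

Section Centralizers.
Variable G : sgraph.
Local Notation A := (raag G).
Local Notation letter := (G * bool)%type.
Implicit Types (a b : letter) (w : word G) (x y z s t g h p q : A) (u v : G) (j k : int).
Local Notation inL a := (in_std (adj a.1)).

Definition star v : pred G := fun u => (u == v) || adj v u.

Lemma starC u v : star u v = star v u.
Proof. by rewrite /star eq_sym adj_sym. Qed.

Lemma inL_star a x : inL a x -> in_std (star a.1) x.
Proof. by apply: in_std_sub => u /=; rewrite /star orbC => ->. Qed.

Lemma centralizer_star a y : commute y (ltr a) -> in_std (star a.1) y.
Proof.
case/centralizer_ltr => j /inL_star h.
have ha : in_std (star a.1) (zpow (ltr a) j).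
  by apply/in_std_zpow/in_std_ltr; rewrite /star eqxx.
by apply/(in_std_mull _ ha).
Qed.

Lemma star_commute a x : in_std (star a.1) x -> commute (ltr a) x.
Proof.
apply: in_std_commute => -[v e] /orP[/eqP /= ->|]; last exact: ltr_commute.
case: a => u d /=; suff h : commute (gen u) (ltr (u, e)).
  by case: d; rewrite // ltr_true; apply/commute_sym/commuteV/commute_sym.
by case: e; rewrite // ltr_true; apply/commuteV.
Qed.

Definition retract (T : pred G) : A -> A :=
  raag_lift (fun v => if T v then gen v else 1).

Lemma retract_commute (T : pred G) u v : adj u v ->
  commute (if T u then gen u else 1) (if T v then gen v else 1).
Proof.
move=> /gen_comm uv; case: ifP => _; case: ifP => _ //; try exact: commute1.
by apply/commute_sym/commute1.
Qed.

Lemma retractM (T : pred G) : {morph retract T : x y / x * y}.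
Proof. exact/raag_liftM/retract_commute. Qed.

Lemma retract_el (T : pred G) w :
  retract T (el w) = el [seq a <- w | T a.1].
Proof.
rewrite /retract lift_el; last exact: retract_commute.
elim: w => [//|[v e] w IH] /=; rewrite IH /lift_ltr /=.
by case: e; case: (T v); rewrite ?el_cons ?ltr_true ?invg1 ?mul1g.
Qed.

Lemma retract_in (T : pred G) x : in_std T (retract T x).
Proof.
have [w ->] := el_surj x; rewrite retract_el; eexists; last by [].
exact: filter_all.
Qed.

Lemma retract_id (T : pred G) x : in_std T x -> retract T x = x.
Proof. by move=> [w /all_filterP h ->]; rewrite retract_el h. Qed.

Lemma retractV (T : pred G) x : retract T x^-1 = (retract T x)^-1.
Proof.
apply: (mulgI (retract T x)); rewrite -retractM !mulgV.
exact: (morph1 (@retractM T)).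
Qed.

(** By [centralizer_ltr] the conjugate lies in the subgroup of the link up to a
    power of [a], and the exponent sum at [a.1] shows that this power is trivial. *)
Lemma conj_ltr_in_link a b z : a.1 != b.1 -> commute (ltr b ^ z) (ltr a) -> inL a (ltr b ^ z).
Proof.
move=> ab /centralizer_ltr [j h]; suff E : j = 0%R by rewrite E mul1g in h.
have := in_std_expsum h (u := a.1); rewrite adj_irrefl => /(_ isT).
rewrite expsumM expsum_zpow expsumJ !expsum_ltr eqxx eq_sym (negPf ab).
by case: a.2; lia.
Qed.

(** The conjugators of two commuting conjugates of adjacent generators agree up
    to centralizers, that is, the cosets attached to the two generators meet.
    The element [p] is obtained by retracting [x * y^-1] to the link of [a.1]. *)
Lemma commute_conj_ltr a b x y : adj a.1 b.1 ->
  commute (ltr a ^ x) (ltr b ^ y) ->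
  exists p q, [/\ inL a p, in_std (star b.1) q & x * y^-1 = p * q].
Proof.
move=> ab C; pose z := x * y^-1; rewrite -/z.
have nab : a.1 != b.1 by apply: contraTneq ab => ->; rewrite adj_irrefl.
have kC : commute (ltr b ^ z^-1) (ltr a).
  have := commuteJ x^-1 C; rewrite -!conjgM mulgV conjg1.
  by rewrite invgM invgK => /commute_sym.
have Lk := conj_ltr_in_link nab kC; clearbody z.
exists (retract (adj a.1) z), ((retract (adj a.1) z)^-1 * z).
split; [exact: retract_in| |by rewrite mulVKg].
apply: centralizer_star; apply/commute_sym/commgP; rewrite -conjg_fix conjgM.
suff <- : ltr b ^ z^-1 = ltr b ^ (retract (adj a.1) z)^-1 by rewrite -conjgM mulVg conjg1.
rewrite -{1}(retract_id Lk) !conjgE !invgK !retractM retractV.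
by rewrite (retract_id (@in_std_ltr _ (adj a.1) b ab)).
Qed.

End Centralizers.

(** * The signed graph symmetry of an automorphism *)

Section Symmetry.
Variable G : sgraph.
Local Notation A := (raag G).
Local Notation letter := (G * bool)%type.
Implicit Types (a b : letter) (w : word G) (x y z s t h p q : A) (u v : G) (j k : int).
Implicit Types (f g : aut A).
Local Notation inL a := (in_std (adj a.1)).
Hypothesis tri : forall u v w : G, adj u v -> adj v w -> adj u w -> False.
Hypothesis sq : forall u u' t t' : G, u <> u' ->
  adj u t -> adj u' t -> adj u t' -> adj u' t' -> t = t'.
Hypothesis deg2 : forall v : G, exists w1 w2 : G, [/\ w1 <> w2, adj v w1 & adj v w2].

Lemma ltr_conj_eq a b x y : ltr a ^ x = ltr b ^ y -> a = b.
Proof.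
move=> E; have : expsum a.1 (ltr a) = expsum a.1 (ltr b) by rewrite -(expsumJ _ _ x) E expsumJ.
rewrite !expsum_ltr eqxx eq_sym; case: eqP => [|_]; last by case: a.2.
by case: a b {E} => u [] [v []] /= ->.
Qed.

Lemma image_ex f v : exists a, exists y, f (gen v) = ltr a ^ y.
Proof. exact: aut_gen. Qed.

Definition image f v : letter := projT1 (cid (image_ex f v)).
Definition image_vertex f v : G := (image f v).1.
Definition image_sign f v : bool := (image f v).2.
Definition image_conj f v : A := projT1 (cid (projT2 (cid (image_ex f v)))).

Lemma imageE f v : f (gen v) = ltr (image_vertex f v, image_sign f v) ^ image_conj f v.
Proof.
rewrite /image_vertex /image_sign -surjective_pairing /image_conj /image.
exact: projT2 (cid (projT2 (cid (image_ex f v)))).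
Qed.

Lemma image_uniq f v u e y : f (gen v) = ltr (u, e) ^ y ->
  image_vertex f v = u /\ image_sign f v = e.
Proof. by rewrite imageE => /ltr_conj_eq [-> ->]. Qed.

Lemma aut_ltr f u e :
  f (ltr (u, e)) = ltr (image_vertex f u, image_sign f u (+) e) ^ image_conj f u.
Proof.
case: e; last by rewrite -[ltr _]/(gen u) imageE addbF.
rewrite ltr_true autV imageE -conjVg addbT -ltr_flip.
by [].
Qed.

Lemma image_mul f g v : (f * g : aut A) (gen v) =
  ltr (image_vertex f (image_vertex g v),
       image_sign f (image_vertex g v) (+) image_sign g v)
  ^ (image_conj f (image_vertex g v) * f (image_conj g v)).
Proof. by rewrite -[LHS]/(f (g (gen v))) imageE autJ aut_ltr conjgM. Qed.

Lemma image_vertexM f g v : image_vertex (f * g) v = image_vertex f (image_vertex g v).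
Proof. by case: (image_uniq (image_mul f g v)). Qed.

Lemma image_signM f g v :
  image_sign (f * g) v = image_sign f (image_vertex g v) (+) image_sign g v.
Proof. by case: (image_uniq (image_mul f g v)). Qed.

Lemma image_vertex1 v : image_vertex 1 v = v.
Proof. by have [] := @image_uniq 1 v v false 1; rewrite ?conjg1. Qed.

Lemma image_sign1 v : image_sign 1 v = false.
Proof. by have [] := @image_uniq 1 v v false 1; rewrite ?conjg1. Qed.

Lemma image_vertexK f : cancel (image_vertex f) (image_vertex f^-1).
Proof. by move=> v; rewrite -image_vertexM mulVg image_vertex1. Qed.

Lemma image_vertexVK f : cancel (image_vertex f^-1) (image_vertex f).
Proof. by move=> v; rewrite -image_vertexM mulgV image_vertex1. Qed.

(** The image of [v] commutes with that of [u], so by [conj_ltr_in_link] a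
    conjugate of it lies in the subgroup of the link of the image vertex of [u];
    exponent sums then show that this link contains the image vertex of [v]. *)
Lemma image_vertex_adj_imp f u v : adj u v -> adj (image_vertex f u) (image_vertex f v).
Proof.
move=> uv; have C := aut_commute f (gen_comm uv); rewrite !imageE in C.
set a := (image_vertex f u, _) in C; set b := (image_vertex f v, _) in C.
have nab : a.1 != b.1.
  by rewrite /= (can_eq (image_vertexK f)); apply: contraTneq uv => ->; rewrite adj_irrefl.
have := commuteJ (image_conj f u)^-1 C; rewrite -!conjgM mulgV conjg1.
move=> /commute_sym /(conj_ltr_in_link nab) h.
apply/negPn/negP => /(in_std_expsum h); rewrite expsumJ expsum_ltr /= eqxx.
by case: image_sign.
Qed.

Lemma image_vertex_adj f u v : adj (image_vertex f u) (image_vertex f v) = adj u v.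
Proof.
apply/idP/idP; last exact: image_vertex_adj_imp.
by move/(image_vertex_adj_imp f^-1); rewrite !image_vertexK.
Qed.

Lemma expsum_aut f u : forall x,
  expsum (image_vertex f u) (f x) = ((-1) ^+ image_sign f u * expsum u x)%R.
Proof.
elim/raag_indr=> [|x [v e] IH]; first by rewrite aut1 !expsum1 GRing.mulr0.
rewrite autM !expsumM IH GRing.mulrDr; congr (_ + _)%R.
rewrite aut_ltr expsumJ !expsum_ltr /= (can_eq (image_vertexK f)).
by case: eqP => [->|_]; rewrite ?GRing.mulr0 //; case: (image_sign f u) e => [] [].
Qed.

End Symmetry.

(** * Automorphisms that preserve the conjugacy classes of generators *)

Section InnerAut.
Variable T : groupType.
Implicit Types (x y g : T).

Definition conj_aut g : aut T :=
  @Aut T (fun x => x ^ g) (fun x y => conjMg x y g)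
    (Bijective (conjgK g) (conjgKV g)).

Lemma conj_aut_inn g : conj_aut g \in @inn T.
Proof. by apply/innP; exists g. Qed.

End InnerAut.

Section PureAut.
Variable G : sgraph.
Local Notation A := (raag G).
Local Notation letter := (G * bool)%type.
Implicit Types (a b : letter) (w : word G) (x y z s h p q : A) (u v : G) (j k : int).
Local Notation inL a := (in_std (adj a.1)).

Lemma aut_gen_ext (f f' : aut A) : (forall v, f (gen v) = f' (gen v)) -> f = f'.
Proof.
move=> E; apply: aut_ext; elim/raag_indr => [|x [v e] IH]; first by rewrite !aut1.
by rewrite !autM IH; case: e; rewrite ?ltr_true ?autV E.
Qed.

Lemma wlen_ltrM a x : (wlen (ltr a * x) <= (wlen x).+1)%N.
Proof. by have [w <- ->] := geodesic x; rewrite -el_cons; apply: wlen_el. Qed.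

Section Conjugators.
Variables (f : aut A) (g : G -> A).
Hypothesis fE : forall v, f (gen v) = gen v ^ g v.
Hypothesis gmin : forall v y, f (gen v) = gen v ^ y -> (wlen (g v) <= wlen y)%N.

Lemma f_ltr a : f (ltr a) = ltr a ^ g a.1.
Proof. by case: a => v []; rewrite ?ltr_true ?autV fE ?conjVg. Qed.

(** The translate by [(g v)^-1] of the half-space beyond the wall of [a], where
    [v = a.1]. As [f] conjugates [v] by [g v], these half-spaces play for the
    action through [f] the part that the half-spaces [side a] play for the action
    by translation. *)
Definition region a x : bool := side a (g a.1 * x).

(** A shortest conjugator [g v] does not begin with [v] or its inverse, even after
    moving letters of the link: such a letter could be dropped. *)
Lemma region1 a : ~~ region a 1.
Proof.
rewrite /region mulg1; apply/negP => ag.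
have [w sw Ew] := geodesic (g a.1).
have [||w1 [b [w2 [E h1 h2]]]] := @walk G (fun x => ~~ side a x) 1 w.
- by rewrite side1.
- by rewrite mul1g -Ew negbK.
rewrite negbK mul1g in h2; rewrite mul1g in h1; have [Eb L] := cross_up h1 h2.
have : (wlen (g a.1) <= wlen (el (w1 ++ w2)))%N.
  apply: gmin; rewrite fE Ew E el_cat el_cons Eb mulgA -(inL_commute L) -mulgA.
  rewrite -(el_cat w1 w2) conjgM; congr (_ ^ _); apply: conjg_commute.
  by case: (a) => v []; rewrite //= ltr_true; apply: commuteV.
by have := wlen_el (w1 ++ w2); rewrite -sw E !size_cat /=; lia.
Qed.

Lemma region_ltrM a x : region a (f (ltr a) * x) = ~~ region (flip a) x.
Proof. by rewrite /region f_ltr conjgE -!mulgA mulVKg side_ltrM. Qed.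

(** The conjugate of [f b] by [(g a.1)^-1] lies in L(a), which stabilizes the
    half-space. *)
Lemma region_adj a b x : adj a.1 b.1 -> region a (f (ltr b) * x) = region a x.
Proof.
move=> ab; have := aut_commute f (ltr_commute ab); rewrite !f_ltr.
move=> /(commuteJ (g a.1)^-1); rewrite -!conjgM mulgV conjg1 => /commute_sym C.
have nab : a.1 != b.1 by apply: contraTneq ab => ->; rewrite adj_irrefl.
have := conj_ltr_in_link nab C; rewrite conjgM => L; rewrite /region.
by rewrite -[RHS](side_mull _ L) [_ ^ (g a.1)^-1]conjgE invgK -!mulgA mulKg.
Qed.

Lemma region_coset a u p : ~~ star u a.1 -> in_std (star u) p ->
  region a ((g u)^-1 * p) = region a (g u)^-1.
Proof. by move=> nua Sp; rewrite /region mulgA (side_off _ Sp). Qed.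

(** The cosets [(g u)^-1 <star u>] and [(g v)^-1 <star v>] meet by
    [commute_conj_ltr], and neither of them crosses a wall labelled [a.1]. *)
Lemma region_adj_const a u v : ~~ star u a.1 -> ~~ star v a.1 -> adj u v ->
  region a (g u)^-1 = region a (g v)^-1.
Proof.
move=> ua va uv; have := aut_commute f (gen_comm uv); rewrite !fE.
move/(@commute_conj_ltr _ (u, false) (v, false)) => /(_ uv) [p [q [Lp Sq E]]].
rewrite -(region_coset ua (inL_star Lp)) -(region_coset va (in_stdV Sq)); congr (region a _).
apply: (mulgI (g u)); rewrite !mulgA mulgV mul1g.
by rewrite E mulgK.
Qed.

Lemma region_disjoint a x : region a x -> ~~ region (flip a) x.
Proof. exact: side_disjoint. Qed.

Lemma region_down a z b : region a z -> ~~ region a (z * ltr b) ->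
  exists2 p, in_std (star a.1) p & z = (g a.1)^-1 * p.
Proof.
rewrite /region mulgA => h1 h2; have [Eb L] := cross_down h1 h2.
exists (g a.1 * z); last by rewrite mulKg.
rewrite -[_ * z](mulgK (ltr b)); apply: in_stdM; first exact: inL_star.
by apply/in_stdV/in_std_ltr; rewrite Eb /= /star eqxx.
Qed.

(** If two overlapping regions with non-commuting labels both avoid the coset of
    the other label, consider a path from a common point to 1. Its first edge out
    of the intersection crosses one of the two walls. But the edges of either
    wall lie in the coset of its own label, hence outside the other region. *)
Lemma region_nested a b x : ~~ star a.1 b.1 -> region a x -> region b x ->
  region a (g b.1)^-1 \/ region b (g a.1)^-1.
Proof.
move=> nab ax bx; apply/orP; rewrite -[_ || _]negbK negb_or.
apply/negP => /andP[na nb].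
have [||z [e [/andP[az bz]]]] := @walk_el G (fun z => region a z && region b z) x 1.
- by rewrite ax.
- by rewrite (negPf (region1 a)).
rewrite negb_and => /orP[h|h].
  have [p Sp Ez] := region_down az h; move: bz.
  by rewrite Ez region_coset // (negPf nb).
have [p Sp Ez] := region_down bz h; move: az.
by rewrite Ez region_coset ?(negPf na) // starC.
Qed.

(** Ping-pong: if the regions of non-commuting labels are disjoint, [f] sends
    every nontrivial element with a geodesic word beginning with [a] into the
    region of [a]. By surjectivity each generator [gen v] lies in some region, and
    being at distance 1 from the base point it forces [g v] to commute with
    [gen v]. *)
Lemma region_pingpong :
  (forall a b x, ~~ star a.1 b.1 -> region a x -> ~~ region b x) ->
  forall v, f (gen v) = gen v.
Proof.
move=> disj.
have suff_geo a w : size (a :: w) = wlen (el (a :: w)) -> size w = wlen (el w).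
  move=> E; apply/eqP; rewrite eqn_leq wlen_el andbT -ltnS.
  by rewrite -[(size w).+1]/(size (a :: w)) E el_cons wlen_ltrM.
have key n w a : (size w <= n)%N -> size (a :: w) = wlen (el (a :: w)) ->
    region a (f (el (a :: w))).
  elim: n w a => [|n IH] [|b w] a // sw geo; rewrite el_cons autM region_ltrM.
  - by rewrite el_nil aut1 region1.
  - by rewrite el_nil aut1 region1.
  have {}sw : (size w <= n)%N by []; have geob := suff_geo _ _ geo.
  have IHb := IH w b sw geob.
  have nab : b <> flip a.
    move=> E; have := wlen_el w; have : el (a :: b :: w) = el w.
      by rewrite !el_cons E ltr_flip mulVKg.
    by move: geo => /= + E1; rewrite E1 => <-; lia.
  case/boolP: (adj a.1 b.1) => ab.
    rewrite el_cons autM region_adj //=.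
    rewrite -[region _ _]negbK -(region_ltrM a) -autM -el_cons negbK.
    apply: IH => //; apply: (suff_geo b).
    have -> : el [:: b, a & w] = el [:: a, b & w] by
      rewrite !el_cons !mulgA (ltr_commute ab).
    exact: geo.
  case: (eqVneq a.1 b.1) => [E|E].
    suff -> : a = b by apply: region_disjoint.
    case: (a) (b) E nab => [u e] [u' e'] /= <-.
    by rewrite /flip /=; case: e e' => [] [].
  by apply: disj IHb; rewrite /= starC /star eq_sym negb_or E.
move=> v; have [x Ex] : exists x, f x = gen v by exists (aut_inv f (gen v)); rewrite autKV.
have [[|a w] sw Ew] := geodesic x.
  by have := congr1 (expsum v) Ex; rewrite Ew el_nil aut1 expsum1 expsum_gen eqxx.
have := key _ w a (leqnn _); rewrite -Ew Ex => /(_ sw) h.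
have := region1 a; rewrite /region mulg1 => n1.
have [Ea L] := cross_up n1 h; rewrite fE; apply: conjg_commute.
by rewrite -Ea in L; exact: (inL_commute L).
Qed.

(** A geodesic from 1 to [(g u)^-1] crosses the wall of [region a] along an edge
    labelled [a]; multiplying by the inverse of [f a] folds the geodesic at this
    edge and removes it. *)
Lemma region_shorten a u : region a (g u)^-1 -> (wlen (g u * f (ltr a)) < wlen (g u))%N.
Proof.
move=> h; have [w sw Ew] := geodesic (g u)^-1.
rewrite -wlenV -[wlen (g u)]wlenV invgM.
have [||w1 [b [w2 [E h1 h2]]]] := @walk G (fun x => ~~ region a x) 1 w.
- exact: region1.
- by rewrite mul1g -Ew negbK.
rewrite negbK mul1g /region mulgA in h2; rewrite mul1g /region in h1.
have [Eb L] := cross_up h1 h2.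
suff -> : (f (ltr a))^-1 * (g u)^-1 = el (w1 ++ w2).
  by apply: leq_ltn_trans (wlen_el _) _; rewrite -sw E !size_cat /=; lia.
rewrite Ew E !el_cat el_cons Eb f_ltr -conjVg conjgE -!mulgA.
apply: (mulgI (g a.1)); rewrite mulVKg !mulgA -[_ * _ * el w1]mulgA.
apply: (mulIg (el w2)^-1); rewrite !mulgK -mulgA -(inL_commute L).
by rewrite mulKg.
Qed.

End Conjugators.

End PureAut.

Section PartialConj.
Variables (G : sgraph) (c : G).
Local Notation A := (raag G).
Local Notation letter := (G * bool)%type.
Implicit Types (a b : letter) (w : word G) (x y z s h p q : A) (u v : G) (j k : int).
Local Notation inL a := (in_std (adj a.1)).

Definition locally_constant (T : Type) v (t : G -> T) :=
  forall u u', ~~ star v u -> ~~ star v u' -> adj u u' -> t u = t u'.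

Lemma star_gen_commute u k : star c u -> commute (gen u) (zpow (gen c) k).
Proof.
move=> cu; apply: commute_zpow; apply: (@star_commute G (u, false)).
by apply: (@in_std_ltr _ _ (c, false)); rewrite starC.
Qed.

Lemma pconj_commute (t : G -> int) : locally_constant c t ->
  forall u v, adj u v ->
  commute (gen u ^ zpow (gen c) (t u)) (gen v ^ zpow (gen c) (t v)).
Proof.
move=> lt.
have half u v : star c u -> adj u v ->
    commute (gen u ^ zpow (gen c) (t u)) (gen v ^ zpow (gen c) (t v)).
  move=> cu uv; have E k : gen u ^ zpow (gen c) k = gen u.
    exact/conjg_commute/star_gen_commute.
  by rewrite E -(E (t v)); apply/commuteJ/gen_comm.
move=> u v uv; case/boolP: (star c u) => cu; first exact: half.
case/boolP: (star c v) => cv.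
  by apply/commute_sym/half; rewrite // adj_sym.
by rewrite (lt _ _ cu cv uv); apply/commuteJ/gen_comm.
Qed.

(** The product of partial conjugations by powers of [c]: the generators in a
    component of the complement of the star of [c] are conjugated by the power of
    [c] prescribed by [t]. The values of [t] on the star of [c] have no effect. *)
Definition pconj (t : G -> int) : A -> A :=
  raag_lift (fun v => gen v ^ zpow (gen c) (t v)).

Section Locally.
Variables (t : G -> int) (lt : locally_constant c t).

Lemma pconjM : {morph pconj t : x y / x * y}.
Proof. exact/raag_liftM/pconj_commute. Qed.

Lemma pconj_gen v : pconj t (gen v) = gen v ^ zpow (gen c) (t v).
Proof. exact/lift_gen/pconj_commute. Qed.

Lemma pconjV x : pconj t x^-1 = (pconj t x)^-1.
Proof.
by apply: (mulgI (pconj t x)); rewrite -pconjM !mulgV (morph1 pconjM).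
Qed.

Lemma pconj_c k : pconj t (zpow (gen c) k) = zpow (gen c) k.
Proof.
have E : pconj t (gen c) = gen c.
  by rewrite pconj_gen; apply/conjg_commute/star_gen_commute; rewrite /star eqxx.
have EX n : pconj t (gen c ^+ n) = gen c ^+ n.
  by elim: n => [|n IH]; rewrite ?(morph1 pconjM) // !expgS pconjM E IH.
by case: k => n; rewrite /zpow ?pconjV EX.
Qed.

End Locally.

Lemma pconj_cancel (t t' : G -> int) : locally_constant c t -> locally_constant c t' ->
  (forall v, t v + t' v = 0)%R -> cancel (pconj t) (pconj t').
Proof.
move=> lt lt' E; elim/raag_indr => [|x [v e] IH].
  by rewrite !(morph1 (pconjM _)).
have Ev : pconj t' (pconj t (gen v)) = gen v.
  rewrite pconj_gen // conjgE !pconjM // pconjV // pconj_c // pconj_gen //.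
  by rewrite -conjgE -conjgM -zpowD GRing.addrC E conjg1.
by rewrite !pconjM // IH; case: e; rewrite ?ltr_true ?pconjV // Ev.
Qed.

Lemma locally_constantN (t : G -> int) :
  locally_constant c t -> locally_constant c (fun v => - t v)%R.
Proof. by move=> lt u u' cu cu' uu'; rewrite (lt u u'). Qed.

Lemma pconj_bij (t : G -> int) : locally_constant c t -> bijective (pconj t).
Proof.
move=> lt; exists (pconj (fun v => - t v)%R); apply: pconj_cancel => // *;
  try exact: locally_constantN; by lia.
Qed.

Definition pconj_aut (t : G -> int) (lt : locally_constant c t) : aut A :=
  Aut (pconjM lt) (pconj_bij lt).

Hypothesis conn : forall v, v <> c -> forall t : G -> bool, locally_constant v t ->
  forall u u', ~~ star v u -> ~~ star v u' -> t u = t u'.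

Definition pure_form (f : aut A) : Prop :=
  exists2 t : G -> int, locally_constant c t &
    exists h, forall v, f (gen v) = gen v ^ (zpow (gen c) (t v) * h).

(** If the coset of [u0] lies in the region of [a], conjugating by [a] all the
    vertices whose cosets lie in this region shortens the conjugators. The set of
    these vertices is a union of components of the complement of the star of
    [a.1]. For [a.1 <> c] it is the whole complement, and the modification is an
    inner automorphism; for [a.1 = c] it is a product of partial conjugations. *)
Lemma pure_step (f : aut A) (g : G -> A) a u0 :
  (forall v, f (gen v) = gen v ^ g v) ->
  (forall v y, f (gen v) = gen v ^ y -> (wlen (g v) <= wlen y)%N) ->
  ~~ star a.1 u0 -> region g a (g u0)^-1 ->
  exists (f' : aut A) (g' : G -> A), [/\ forall v, f' (gen v) = gen v ^ g' v,
    (\sum_v wlen (g' v) < \sum_v wlen (g v))%N & pure_form f' -> pure_form f].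
Proof.
move=> fE gmin au0 du0; pose K u := ~~ star a.1 u && region g a (g u)^-1.
have lK : locally_constant a.1 K.
  move=> u u' au au' uu'; rewrite /K au au' /=.
  by apply: (region_adj_const fE _ _ uu'); rewrite starC.
(* Conjugators of [f * p], where [p] conjugates the generators in [K] by [a]. *)
pose g' u := if K u then g u * f (ltr a) else g u.
have sum_lt : (\sum_v wlen (g' v) < \sum_v wlen (g v))%N.
  rewrite (bigD1 u0) //= [X in (_ < X)%N](bigD1 u0) //= -addSn leq_add //.
    by rewrite /g' /K au0 du0 /= (region_shorten fE).
  apply: leq_sum => i _; rewrite /g'; case: ifP => // /andP[_ du].
  exact/ltnW/(region_shorten fE).
have pE (p : aut A) : (forall v, p (gen v) = if K v then gen v ^ ltr a else gen v) ->
    forall v, (f * p : aut A) (gen v) = gen v ^ g' v.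
  move=> pE v; rewrite -[LHS]/(f (p (gen v))) pE /g'; case: ifP => _ //.
  by rewrite autJ fE conjgM.
case: (eqVneq a.1 c) => [ac|/eqP ac].
  pose e : int := (if a.2 then - 1 else 1)%R.
  have ae : zpow (gen c) e = ltr a.
    by rewrite /e -ac; case: (a) => v [] //=; rewrite ltr_true.
  pose t u : int := if K u then e else 0%R.
  have lt : locally_constant c t by move=> u u'; rewrite -ac /t => *; rewrite (lK u u').
  exists (f * pconj_aut lt), g'; split=> //.
    apply: pE => v; rewrite [LHS]pconj_gen //= /t.
    by case: ifP => _; rewrite ?ae // zpow0 conjg1.
  move=> [t' lt' [h hE]]; exists (fun v => t' v - t v)%R.
    by move=> u u' cu cu' uu'; rewrite (lt u u') // (lt' u u').
  exists h => v.
  have fc : f (zpow (gen c) (- t v)%R) = zpow (gen c) (- t v)%R ^ h.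
    have := hE c; rewrite -[LHS]/(f (pconj t (gen c))) -(zpow1 (gen c)) pconj_c //.
    rewrite zpow1 conjgM [gen c ^ _](conjg_commute (star_gen_commute _ _)) => [E|].
      by rewrite aut_zpow E zpowJ.
    by rewrite /star eqxx.
  have <- : pconj t (gen v) ^ zpow (gen c) (- t v)%R = gen v.
    by rewrite pconj_gen // -conjgM -zpowD GRing.subrr conjg1.
  rewrite autJ -[f (pconj t _)]/((f * pconj_aut lt : aut A) (gen v)) hE fc.
  rewrite pconj_gen // -!conjgM; congr (_ ^ _).
  rewrite -[LHS]mulgA -conjgC !mulgA; congr (_ * h).
  by rewrite -!zpowD; congr zpow; lia.
have K_all u : K u = ~~ star a.1 u.
  case/boolP: (star a.1 u) => au; first by rewrite /K au.
  by rewrite (conn ac lK au au0) /K au0 du0.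
exists (f * conj_aut (ltr a)), g'; split=> //.
  apply: pE => v; rewrite K_all -[LHS]/(gen v ^ ltr a).
  case: ifPn => // /negPn av; apply: conjg_commute.
  apply: (@star_commute G (v, false)).
  by apply: in_std_ltr; rewrite starC.
move=> [t lt [h hE]]; exists t => //; exists (h * (f (ltr a))^-1) => v.
have := hE v; rewrite -[LHS]/(f (gen v ^ ltr a)) autJ => E.
by rewrite mulgA conjgM -E conjgK.
Qed.

(** Laurence's theorem on conjugating automorphisms in this setting, by induction
    on the total length of the conjugators: either two regions overlap and
    [pure_step] applies, or [region_pingpong] shows that nothing is left. *)
Lemma pureP (f : aut A) (g : G -> A) :
  (forall v, f (gen v) = gen v ^ g v) -> pure_form f.
Proof.
have [n] := ubnP (\sum_v wlen (g v)).
elim: n f g => // n IH f g; rewrite ltnS => gn fE.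
case: (pselect (forall v y, f (gen v) = gen v ^ y -> (wlen (g v) <= wlen y)%N)); last first.
  move=> /existsNP[v /existsNP[y /not_implyP[fv /negP]]]; rewrite -ltnNge => lt.
  pose g' u := if u == v then y else g u.
  apply: (IH f g'); last by move=> u; rewrite /g'; case: eqP => [->|].
  apply: leq_trans gn; rewrite (bigD1 v) //= [X in (_ < X)%N](bigD1 v) //=.
  rewrite /g' eqxx -addSn leq_add //.
  by apply: leq_sum => u /negPf ->.
move=> gmin.
case: (pselect (forall a b x, ~~ star a.1 b.1 -> region g a x -> ~~ region g b x)).
  move=> /(region_pingpong fE gmin) E; exists (fun=> 0%R) => //.
  by exists 1 => v; rewrite E mulg1 conjg1.
move=> /existsNP[a /existsNP[b /existsNP[x]]].
move=> /not_implyP[ab /not_implyP[ax /negP/negPn bx]].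
have step a' u0 : ~~ star a'.1 u0 -> region g a' (g u0)^-1 -> pure_form f.
  move=> h1 h2; have [f' [g' [f'E lt]]] := pure_step fE gmin h1 h2.
  by apply; apply: (IH f' g') => //; apply: leq_trans gn.
have [h|h] := region_nested fE gmin ab ax bx; first exact: step h.
by apply: step h; rewrite starC.
Qed.

End PartialConj.

(** * Matrices acting on groups with a crossed homomorphism to Z^n *)

Section Copies.
Variables (G H : groupType) (f : H -> G).
Hypothesis fM : {morph f : x y / x * y}.

Definition image_pred : {pred G} := [pred y : G | `[< exists x, f x = y >]].

Lemma image_predP y : reflect (exists x, f x = y) (y \in image_pred).
Proof. exact: asboolP. Qed.

Lemma image_pred1 : 1 \in image_pred.
Proof. by apply/image_predP; exists 1; apply: morph1. Qed.

Lemma image_predM : mulg_closed image_pred.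
Proof.
move=> _ _ /image_predP[x <-] /image_predP[y <-].
by apply/image_predP; exists (x * y).
Qed.

Lemma image_predV : invg_closed image_pred.
Proof.
move=> _ /image_predP[x <-]; apply/image_predP; exists x^-1.
by apply: (mulgI (f x)); rewrite -fM !mulgV (morph1 fM).
Qed.

HB.instance Definition _ := isMulClosed.Build G image_pred image_predM.
HB.instance Definition _ := isMul1Closed.Build G image_pred image_pred1.
HB.instance Definition _ := isInvClosed.Build G image_pred image_predV.
HB.instance Definition _ := isMultiplicative.Build H G f fM.

Lemma contains_copy_inj : injective f -> contains_copy G H.
Proof.
move=> fI; exists (GroupClosed.clone G image_pred _), (Multiplicative.clone H G f _); split=> // y.
by split=> [/image_predP|/image_predP].
Qed.

End Copies.

Section TwistedAction.
Variables (T : groupType) (n : nat).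
Local Notation vec := 'cV[int]_n.
Variables (io : vec -> T) (m : T -> vec) (s : T -> bool) (z : T).
Implicit Types (x y : vec) (g h : T) (M N : 'M[int]_n).

Hypothesis ioD : forall x y, io (x + y)%R = io x * io y.
Hypothesis mK : cancel io m.
Hypothesis s_io : forall x, s (io x) = false.
Hypothesis mM : forall g h, m (g * h) = (m g + (-1) ^+ s g *: m h)%R.
Hypothesis ioJ : forall g x, g * io x = io ((-1) ^+ s g *: x)%R * g.
Hypothesis zJ : forall g, z * g = io (- (m g *+ 2))%R * g * z.

(** A semidirect product of an abelian group Z^n and a group acting on it by
    signs has the automorphisms that act by a matrix on Z^n and fix the
    complement. The crossed homomorphism [m] stands for the projection to Z^n;
    with it the complement need not be mentioned. *)
Definition theta M g : T := io ((M - 1%:M) *m m g)%R * g.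

Lemma io0 : io 0%R = 1.
Proof. by apply: (mulgI (io 0%R)); rewrite -ioD GRing.addr0 mulg1. Qed.

Lemma m_theta M g : m (theta M g) = (M *m m g)%R.
Proof.
rewrite /theta mM s_io mK GRing.expr0 GRing.scale1r mulmxBl mul1mx.
by rewrite GRing.subrK.
Qed.

Lemma theta_comp M N g : theta M (theta N g) = theta (M *m N)%R g.
Proof.
rewrite {1}/theta m_theta /theta mulgA -ioD; congr (io _ * _).
by rewrite mulmxA -mulmxDl mulmxBl mul1mx GRing.addrA GRing.subrK.
Qed.

Lemma theta1 g : theta 1%:M%R g = g.
Proof. by rewrite /theta GRing.subrr mul0mx io0 mul1g. Qed.

Lemma thetaM M : {morph theta M : g h / g * h}.
Proof.
move=> g h; rewrite /theta mM mulmxDr ioD -scalemxAr !mulgA; congr (_ * _).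
by rewrite -!mulgA; congr (_ * _); rewrite ioJ.
Qed.

Lemma theta_bij (M : GLZ n) : bijective (theta M).
Proof.
exists (theta ((M^-1)%g : GLZ n)) => g; rewrite theta_comp.
  by rewrite -[(_ *m _)%R]/(glz_val (M^-1 * M)) mulVg theta1.
by rewrite -[(_ *m _)%R]/(glz_val (M * M^-1)) mulgV theta1.
Qed.

Definition theta_aut (M : GLZ n) : aut T := Aut (@thetaM M) (theta_bij M).

Lemma theta_autM : {morph theta_aut : M N / M * N}.
Proof. by move=> M N; apply: aut_ext => g; rewrite [RHS]theta_comp. Qed.

Lemma theta_autV (M : GLZ n) : theta_aut M^-1 = (theta_aut M)^-1.
Proof.
by apply: (mulgI (theta_aut M)); rewrite -theta_autM !mulgV (morph1 theta_autM).
Qed.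

(** An inner automorphism acts on the image of [io] by a sign; conversely
    [zJ] says that the matrix -1 acts as conjugation by [z]. *)
Lemma theta_inn (M : GLZ n) : (theta_aut M \in @inn T) = (M \in @pm1 n).
Proof.
apply/innP/idP => [[h E]|].
  have MD x : ((M : 'M_n) *m x = (-1) ^+ s h^-1 *: x)%R.
    have := congr1 m (E (io x)); rewrite [m _]m_theta mK => ->.
    rewrite conjgE mulgA ioJ -mulgA mulVg mulg1 mK.
    by [].
  rewrite inE /=.
  have {MD} Mj i j : (glz_val M i j = (-1) ^+ s h^-1 * (i == j)%:R)%R.
    have := congr1 (fun A : vec => A i 0%R) (MD (delta_mx j 0%R)).
    by rewrite -colE !mxE eqxx andbT.
  apply/orP; case: (s _) Mj => Mj; [right|left]; apply/eqP/matrixP => i j;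
    by rewrite Mj !mxE ?GRing.mul1r ?GRing.expr1 ?GRing.mulN1r.
rewrite inE /= => /orP[]/eqP E.
  by exists 1 => g; rewrite conjg1 /= E theta1.
exists z^-1 => g; rewrite conjgE invgK mulgA zJ mulgK /= E /theta.
congr (io _ * _); rewrite mulmxBl mulNmx mul1mx.
by rewrite -GRing.opprD GRing.mulr2n.
Qed.

Definition pgl_out (P : PGLZ n) : Out T := \pi_(quotient_group (@inn T)) (theta_aut (repr P)).

Lemma pgl_out_pi (M : GLZ n) :
  pgl_out (\pi_(quotient_group (@pm1 n)) M) = \pi_(quotient_group (@inn T)) (theta_aut M).
Proof.
apply/cosetP; rewrite -theta_autV -theta_autM theta_inn; apply/cosetP.
by rewrite reprK.
Qed.

Lemma pgl_outM : {morph pgl_out : P Q / P * Q}.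
Proof.
move=> P Q; rewrite -[P]reprK -[Q]reprK; move: (repr P) (repr Q) => M N.
rewrite -[_ * _]/(quotient_mul _ _) pi_quotientM !pgl_out_pi theta_autM.
by rewrite -[RHS]/(quotient_mul _ _) pi_quotientM.
Qed.

Lemma pgl_out_inj : injective pgl_out.
Proof.
move=> P Q; rewrite -[P]reprK -[Q]reprK !pgl_out_pi => /cosetP.
by rewrite -theta_autV -theta_autM theta_inn => /cosetP.
Qed.

Lemma contains_PGL : contains_copy (Out T) (PGLZ n).
Proof. exact: contains_copy_inj pgl_outM pgl_out_inj. Qed.

End TwistedAction.

(** * The outer automorphism group of a right-angled Artin group *)

Section OutClass.
Variable T : groupType.
Implicit Types f g : aut T.

Definition cls f : Out T := \pi_(quotient_group (@inn T)) f.

Lemma clsM f g : cls (f * g) = cls f * cls g.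
Proof. by rewrite /cls -[RHS]/(quotient_mul _ _) pi_quotientM. Qed.

Lemma cls_repr (o : Out T) : cls (repr o) = o.
Proof. by rewrite /cls reprK. Qed.

Lemma cls_eq f g : cls f = cls g -> exists h, g = f * conj_aut h.
Proof.
move=> /cosetP /innP[h E]; exists h; rewrite -[g](mulKg f^-1) invgK.
by congr (_ * _); apply: aut_ext => x; rewrite E.
Qed.

Lemma cls_conj h : cls (conj_aut h) = 1.
Proof.
by apply/esym/cosetP; rewrite invg1 mul1g conj_aut_inn.
Qed.

End OutClass.

Section OutRaag.
Variables (G : sgraph) (c : G) (n : nat).
Variables (branch : G -> 'I_n.+1) (rep : 'I_n.+1 -> G).
Local Notation A := (raag G).
Local Notation vec := 'cV[int]_n.
Implicit Types (u v : G) (f g : aut A) (x y : vec).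

Hypothesis tri : forall u v w : G, adj u v -> adj v w -> adj u w -> False.
Hypothesis sq : forall u u' t t' : G, u <> u' ->
  adj u t -> adj u' t -> adj u t' -> adj u' t' -> t = t'.
Hypothesis deg2 : forall v : G, exists w1 w2 : G, [/\ w1 <> w2, adj v w1 & adj v w2].
Hypothesis conn : forall v, v <> c -> forall t : G -> bool, locally_constant v t ->
  forall u u', ~~ star v u -> ~~ star v u' -> t u = t u'.
Hypothesis branch_lc : locally_constant c branch.
Hypothesis branch_conn : forall t : G -> int, locally_constant c t ->
  forall u u', ~~ star c u -> ~~ star c u' -> branch u = branch u' -> t u = t u'.
Hypothesis rep_off : forall i, ~~ star c (rep i).
Hypothesis repK : cancel rep branch.
Hypothesis sym : forall r : G -> G, bijective r ->
  (forall u v, adj (r u) (r v) = adj u v) ->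
  r c = c /\ forall u, ~~ star c u -> branch (r u) = branch u.

Local Notation image_vertex := (image_vertex tri sq deg2).
Local Notation image_sign := (image_sign tri sq deg2).
Local Notation image_conj := (image_conj tri sq deg2).

Lemma image_vertex_sym f :
  image_vertex f c = c /\ forall u, ~~ star c u -> branch (image_vertex f u) = branch u.
Proof.
apply: sym; last by move=> u v; apply: image_vertex_adj.
by exists (image_vertex f^-1); [apply: image_vertexK|apply: image_vertexVK].
Qed.

Lemma image_vertex_star f u : star c (image_vertex f u) = star c u.
Proof.
have [fc _] := image_vertex_sym f.
by rewrite -{1}fc /star (image_vertex_adj tri sq deg2) (can_eq (image_vertexK tri sq deg2 f)).
Qed.

(** Off the star of [c] the conjugator of the image of [v] is determined up to
    elements with zero exponent sum at [c]. *)
Definition twist f v : int := expsum c (image_conj f v).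

(** Two conjugators differ by an element of the centralizer of the letter, which
    is generated by a star that does not contain [c]. *)
Lemma twist_uniq f v (a : G * bool) (y : A) :
  ~~ star c v -> f (gen v) = ltr a ^ y -> twist f v = expsum c y.
Proof.
move=> cv E; have := E; rewrite (imageE tri sq deg2) => E'.
have Ea := ltr_conj_eq E'; rewrite Ea in E'.
have : commute (image_conj f v * y^-1) (ltr a).
  by apply/commute_sym/commgP; rewrite -conjg_fix conjgM E' conjgK.
move=> /centralizer_star /in_std_expsum h.
have {h} : expsum c (image_conj f v * y^-1) = 0%R.
  by apply: h; rewrite starC -Ea /= image_vertex_star.
by rewrite expsumM expsumV /twist; lia.
Qed.

Lemma twist_lc f : locally_constant c (twist f).
Proof.
move=> u v cu cv uv; have := aut_commute f (gen_comm uv).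
rewrite !(imageE tri sq deg2) => /commute_conj_ltr h.
have [|p [q [/in_std_expsum Lp /in_std_expsum Sq E]]] := h.
  by rewrite /= image_vertex_adj.
have {h} := congr1 (expsum c) E; rewrite !expsumM expsumV Lp ?Sq; first by rewrite /twist; lia.
  by rewrite starC /= image_vertex_star.
by have := cu; rewrite -(image_vertex_star f) starC /star negb_or => /andP[].
Qed.

Lemma twistM f g v : ~~ star c v ->
  twist (f * g) v = (twist f v + (-1) ^+ image_sign f c * twist g v)%R.
Proof.
move=> cv; rewrite (twist_uniq cv (image_mul tri sq deg2 f g v)) expsumM.
have [fc _] := image_vertex_sym f; have [_ gk] := image_vertex_sym g.
have := expsum_aut tri sq deg2 f c (image_conj g v); rewrite fc => ->; congr (_ + _)%R.
by apply: (branch_conn (@twist_lc f)); rewrite ?image_vertex_star // gk.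
Qed.

(** Subtracting the value on one component kills the inner automorphisms, which
    shift all twists by the same amount. *)
Definition twist_vec f : vec :=
  (\col_i (twist f (rep (lift ord0 i)) - twist f (rep ord0)))%R.

Lemma twist_vecM f g :
  twist_vec (f * g) = (twist_vec f + (-1) ^+ image_sign f c *: twist_vec g)%R.
Proof.
by apply/matrixP => i j; rewrite !mxE !twistM //; lia.
Qed.

Lemma image_sign_center f g : image_sign (f * g) c = image_sign f c (+) image_sign g c.
Proof. by rewrite image_signM; have [-> _] := image_vertex_sym g. Qed.

Lemma twist_vec_eq f (h : A) (t : G -> int) :
  (forall v, f (gen v) = gen v ^ (zpow (gen c) (t v) * h)) ->
  twist_vec f = (\col_i (t (rep (lift ord0 i)) - t (rep ord0)))%R.
Proof.
move=> E; apply/matrixP => i j; rewrite !mxE.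
by rewrite !(twist_uniq _ (E _)) // !expsumM !expsum_zpow expsum_gen eqxx; lia.
Qed.

Lemma twist_vec_conj h : twist_vec (conj_aut h) = 0%R.
Proof.
rewrite (@twist_vec_eq _ h (fun=> 0%R)); last by move=> v; rewrite mul1g.
by apply/matrixP => i j; rewrite !mxE.
Qed.

Lemma image_sign_conj h : image_sign (conj_aut h) c = false.
Proof. by have [] := image_uniq tri sq deg2 (f := conj_aut h) (erefl (gen c ^ h)). Qed.

Definition out_twist (o : Out A) : vec := twist_vec (repr o).
Definition out_sign (o : Out A) : bool := image_sign (repr o) c.

Lemma out_twist_cls f : out_twist (cls f) = twist_vec f.
Proof.
have [h E] := cls_eq (esym (cls_repr (cls f))).
by rewrite /out_twist E twist_vecM twist_vec_conj GRing.scaler0 GRing.addr0.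
Qed.

Lemma out_sign_cls f : out_sign (cls f) = image_sign f c.
Proof.
have [h E] := cls_eq (esym (cls_repr (cls f))).
by rewrite /out_sign E image_sign_center image_sign_conj addbF.
Qed.

Definition shifts x u : int := if unlift ord0 (branch u) is Some i then x i 0%R else 0%R.

Lemma shifts_lc x : locally_constant c (shifts x).
Proof. by move=> u v cu cv uv; rewrite /shifts (branch_lc cu cv uv). Qed.

Definition io x : Out A := cls (pconj_aut (shifts_lc x)).

Lemma pconj_autE x v : pconj_aut (shifts_lc x) (gen v) = gen v ^ zpow (gen c) (shifts x v).
Proof. exact/pconj_gen/shifts_lc. Qed.

Lemma ioD x y : io (x + y)%R = io x * io y.
Proof.
rewrite /io -clsM; congr cls; apply: aut_gen_ext => v.
rewrite pconj_autE -[RHS]/(pconj_aut (shifts_lc x) (pconj_aut (shifts_lc y) (gen v))).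
have Ec k : pconj_aut (shifts_lc x) (zpow (gen c) k) = zpow (gen c) k.
  exact: pconj_c (shifts_lc x) k.
rewrite pconj_autE autJ Ec pconj_autE -conjgM -zpowD; congr (_ ^ zpow _ _).
by rewrite /shifts; case: (unlift _ _) => [i|//]; rewrite mxE.
Qed.

Lemma twist_vec_pconj x : twist_vec (pconj_aut (shifts_lc x)) = x.
Proof.
rewrite (@twist_vec_eq _ 1 (shifts x)); last by move=> v; rewrite mulg1 pconj_autE.
apply/matrixP => i j; rewrite !mxE /shifts !repK liftK unlift_none ord1.
by rewrite GRing.subr0.
Qed.

Lemma pconj_image x v :
  image_vertex (pconj_aut (shifts_lc x)) v = v /\
  image_sign (pconj_aut (shifts_lc x)) v = false.
Proof. exact/image_uniq/pconj_autE. Qed.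

Lemma out_twistK : cancel io out_twist.
Proof. by move=> x; rewrite out_twist_cls twist_vec_pconj. Qed.

Lemma out_sign_io x : out_sign (io x) = false.
Proof. by rewrite out_sign_cls; case: (pconj_image x c). Qed.

Lemma out_twistM (o o' : Out A) :
  out_twist (o * o') = (out_twist o + (-1) ^+ out_sign o *: out_twist o')%R.
Proof. by rewrite -[o]cls_repr -[o']cls_repr -clsM !out_twist_cls out_sign_cls twist_vecM. Qed.

(** By [pureP] the automorphism is a partial conjugation up to an inner one, and
    the exponents are read off from the twists. *)
Lemma pure_cls f :
  (forall v, image_vertex f v = v /\ image_sign f v = false) ->
  cls f = io (twist_vec f).
Proof.
move=> pf; have fE v : f (gen v) = gen v ^ image_conj f v.
  by rewrite (imageE tri sq deg2) (pf v).1 (pf v).2.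
have [t lt [h hE]] := pureP conn fE.
(* The exponents are normalized to vanish on the component of [rep ord0]. *)
pose k := zpow (gen c) (t (rep ord0)) * h.
suff E : f = conj_aut k * pconj_aut (shifts_lc (twist_vec f)).
  by rewrite {1}E clsM cls_conj mul1g.
apply: aut_gen_ext => v; rewrite hE -[RHS]/(pconj_aut (shifts_lc (twist_vec f)) (gen v) ^ k).
rewrite pconj_autE; case/boolP: (star c v) => cv.
  have E k' (z : A) : gen v ^ (zpow (gen c) k' * z) = gen v ^ z.
    by rewrite conjgM (conjg_commute (star_gen_commute _ cv)).
  by rewrite -conjgM !E.
rewrite -conjgM mulgA -zpowD; congr (_ ^ (zpow _ _ * _)).
rewrite (twist_vec_eq hE) /shifts; case: unliftP => [i|] E; rewrite ?mxE.
  by rewrite (branch_conn lt cv (rep_off (lift ord0 i))) ?repK //; lia.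
by rewrite (branch_conn lt cv (rep_off ord0)) ?repK //; lia.
Qed.

Lemma twist_vec1 : twist_vec 1 = 0%R.
Proof.
rewrite (@twist_vec_eq 1 1 (fun=> 0%R)); last by move=> v; rewrite mulg1 conjg1.
by apply/matrixP => i j; rewrite !mxE.
Qed.

Lemma twist_vecV f : ((-1) ^+ image_sign f c *: twist_vec (f^-1)%g = - twist_vec f)%R.
Proof.
have := twist_vecM f f^-1; rewrite mulgV twist_vec1 => /esym/eqP.
by rewrite GRing.addrC GRing.addr_eq0 => /eqP.
Qed.

Lemma image_sign_inv f v : image_sign f (image_vertex f^-1 v) = image_sign f^-1 v.
Proof.
have := image_signM tri sq deg2 f f^-1 v; rewrite mulgV image_sign1.
by case: (image_sign f _); case: (image_sign f^-1 v).
Qed.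

(** The conjugate of a partial conjugation fixes every conjugacy class of
    generators, so it is again a partial conjugation by [pure_cls], and the
    crossed homomorphism gives its exponents. *)
Lemma ioJ (o : Out A) x : o * io x = io ((-1) ^+ out_sign o *: x)%R * o.
Proof.
rewrite -[o]cls_repr; move: (repr o) => f; rewrite out_sign_cls.
set p := pconj_aut (shifts_lc x); rewrite -[io x]/(cls p).
have -> : io ((-1) ^+ image_sign f c *: x)%R = cls (f * p * f^-1).
  rewrite pure_cls => [|v].
    congr io; rewrite !twist_vecM twist_vec_pconj image_sign_center.
    rewrite (pconj_image x c).2 addbF twist_vecV.
    by rewrite GRing.addrAC GRing.subrr GRing.add0r.
  have [pv pe] := pconj_image x (image_vertex f^-1 v).
  by rewrite !image_vertexM !image_signM -/p pv pe image_vertexVK addbF image_sign_inv addbb.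
by rewrite -!clsM mulgVK.
Qed.

Definition cinv_fun : A -> A := raag_lift (fun v => if v == c then (gen v)^-1 else gen v).

Lemma cinv_commute u v : adj u v ->
  commute (if u == c then (gen u)^-1 else gen u) (if v == c then (gen v)^-1 else gen v).
Proof.
move=> uv; have h e e' : commute (ltr (u, e)) (ltr (v, e')) by apply: ltr_commute.
by case: ifP; case: ifP => _ _; rewrite -?ltr_true; apply: h.
Qed.

Lemma cinv_funM : {morph cinv_fun : x y / x * y}.
Proof. exact/raag_liftM/cinv_commute. Qed.

Lemma cinv_gen v : cinv_fun (gen v) = ltr (v, v == c).
Proof.
rewrite /cinv_fun lift_gen; last exact: cinv_commute.
by case: eqP; rewrite ?ltr_true.
Qed.

Lemma cinvK : involutive cinv_fun.
Proof.
have V z : cinv_fun z^-1 = (cinv_fun z)^-1.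
  by apply: (mulgI (cinv_fun z)); rewrite -cinv_funM !mulgV (morph1 cinv_funM).
have Egen v : cinv_fun (cinv_fun (gen v)) = gen v.
  by rewrite cinv_gen; case E : (v == c); rewrite ?ltr_true ?V cinv_gen E ?ltr_true ?invgK.
elim/raag_indr => [|z [v e] IH]; first by rewrite !(morph1 cinv_funM).
by rewrite !cinv_funM IH; case: e; rewrite ?ltr_true ?V Egen.
Qed.

(** The inversion of the generator [c], which inverts all partial conjugations
    and commutes with the symmetries of the graph that fix [c]. *)
Definition cinv : aut A := Aut cinv_funM (Bijective cinvK cinvK).

Lemma cinv_image v : image_vertex cinv v = v /\ image_sign cinv v = (v == c).
Proof.
by apply: (@image_uniq _ tri sq deg2 cinv v v (v == c) 1); rewrite conjg1; apply: cinv_gen.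
Qed.

Lemma cinvV : cinv^-1 = cinv.
Proof. by apply/mulg1_eq/aut_ext => z; apply: cinvK. Qed.

Lemma twist_vec_cinv : twist_vec cinv = 0%R.
Proof.
apply/matrixP => i j; rewrite !mxE.
have E v : cinv (gen v) = ltr (v, v == c) ^ 1 by rewrite conjg1; apply: cinv_gen.
by rewrite !(twist_uniq _ (E _)) // expsum1.
Qed.

(** The commutator of the inversion of [c] with [f] permutes no generators and
    inverts none, so [pure_cls] applies to it. *)
Lemma zJ (o : Out A) : cls cinv * o = io (- (out_twist o *+ 2))%R * o * cls cinv.
Proof.
rewrite -[o]cls_repr; move: (repr o) => f; rewrite out_twist_cls.
have -> : io (- (twist_vec f *+ 2))%R = cls (cinv * f * cinv^-1 * f^-1).
  rewrite pure_cls => [|v].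
    congr io; rewrite -!mulgA !twist_vecM twist_vec_cinv cinvV (cinv_image c).2 eqxx.
    rewrite twist_vec_cinv !GRing.add0r GRing.expr1 GRing.scaleN1r GRing.scaleN1r GRing.scalerN twist_vecV GRing.opprK.
    by rewrite GRing.mulr2n.
  rewrite !image_vertexM !image_signM cinvV.
  have [E1 E2] := cinv_image (image_vertex f^-1 v); rewrite E1 E2 image_vertexVK.
  have [E3 E4] := cinv_image v; rewrite E3 E4; split=> //.
  have [fc _] := image_vertex_sym f^-1.
  rewrite -{2}fc (can_eq (image_vertexK tri sq deg2 f^-1)).
  by rewrite image_sign_inv; case: (v == c); case: (image_sign f^-1 v).
by rewrite -!clsM mulgVK mulgVK.
Qed.

Lemma Out_Out_contains_PGL : contains_copy (Out (Out A)) (PGLZ n).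
Proof. exact: (contains_PGL ioD out_twistK out_sign_io out_twistM ioJ zJ). Qed.

End OutRaag.

(** * The graphs *)

Local Close Scope group_scope.
Local Close Scope quotient_scope.

Section Focus.
Variable G : sgraph.
Implicit Types u v : G.

Lemma mem_st v u : (u \in st v) = star v u.
Proof. by rewrite in_setU1 inE. Qed.

(** Connectivity in the form used for walls: locally constant functions are
    constant. The function to test is reachability from a given vertex. *)
Lemma connected_del v :
  (forall t : G -> bool, locally_constant v t ->
     forall u u', ~~ star v u -> ~~ star v u' -> t u = t u') ->
  connected (del_set (st v)).
Proof.
move=> h x y.
pose t u := if insub u is Some z then connect (@adj (del_set (st v))) x z else false.
have tE (z : del_set (st v)) : t (val z) = connect (@adj (del_set (st v))) x z.
  by rewrite /t valK.
have lt : locally_constant v t.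
  move=> u u'; rewrite -!mem_st => uv u'v uu'.
  rewrite -[u]/(val (Sub u uv : del_set (st v))) -[u']/(val (Sub u' u'v : del_set (st v))).
  rewrite !tE; apply/idP/idP => /connect_trans; apply; apply: connect1 => //.
  by rewrite /= /del_adj /= adj_sym.
rewrite -tE (h t lt (val y) (val x)) -?mem_st; [|exact: (valP y)|exact: (valP x)].
by rewrite tE connect0.
Qed.

Lemma connected_del_constant v (t : G -> bool) :
  connected (del_set (st v)) -> locally_constant v t ->
  forall u u', ~~ star v u -> ~~ star v u' -> t u = t u'.
Proof.
move=> C lt u u'; rewrite -!mem_st => uv u'v.
have /connectP[p pth E] := C (Sub u uv) (Sub u' u'v).
rewrite -[u]/(val (Sub u uv : del_set (st v))) -[u']/(val (Sub u' u'v : del_set (st v))).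
rewrite E {E}; elim: p (Sub u uv : del_set (st v)) pth => [//|z p IH] x /= /andP[xz /IH <-].
by apply: lt => //; rewrite -mem_st; [exact: (valP x)|exact: (valP z)].
Qed.

Hypothesis tri : forall u v w : G, adj u v -> adj v w -> adj u w -> False.
Hypothesis sq : forall u u' t t' : G, u <> u' ->
  adj u t -> adj u' t -> adj u t' -> adj u' t' -> t = t'.
Hypothesis deg2 : forall v : G, exists w1 w2 : G, [/\ w1 <> w2, adj v w1 & adj v w2].

(** Two neighbours of [v] in the star of [u] would close a triangle or a square. *)
Lemma no_domination u v : dominates u v -> u = v.
Proof.
move=> /subsetP D; apply: contrapT => uv; have [w1 [w2 [w12 v1 v2]]] := deg2 v.
have := D w1; have := D w2; rewrite !inE v1 v2 => /(_ isT) + /(_ isT).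
case/orP => [/eqP E2|u2] /orP[/eqP E1|u1].
- by apply: w12; rewrite E1 E2.
- by rewrite -E2 in u1; apply: (tri v2 u1).
- by rewrite -E1 in u2; apply: (tri v1 u2).
- by apply: w12; apply: (sq uv).
Qed.

End Focus.

(** A cycle of length [s] minus the vertex [j] is connected: indices below [j]
    descend to 0, those above [j] ascend to [s.-1], and the closing edge joins
    the two ends. For [j] out of range this is the connectivity of the cycle. *)
Lemma cycle_minus_constant (X : Type) (t : nat -> X) (s j : nat) :
  (forall i, i.+1 < s -> i <> j -> i.+1 <> j -> t i = t i.+1) ->
  (0 <> j -> s.-1 <> j -> t 0 = t s.-1) ->
  forall i i', i < s -> i' < s -> i <> j -> i' <> j -> t i = t i'.
Proof.
move=> tS t0.
have low i : i < s -> i < j -> t i = t 0.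
  elim: i => // i IH si ij; have <- : t i = t i.+1 by apply: tS; lia.
  by apply: IH; lia.
have high d : d < s -> j < s.-1 - d -> t (s.-1 - d) = t s.-1.
  elim: d => [|d IH] sd jd; first by rewrite subn0.
  rewrite -IH; try lia.
  have -> : s.-1 - d = (s.-1 - d.+1).+1 by lia.
  by apply: tS; lia.
have high' i : i < s -> j < i -> t i = t s.-1.
  move=> si ji; have E : s.-1 - (s.-1 - i) = i by lia.
  by have := high (s.-1 - i); rewrite E; apply; lia.
have link i : i < s -> i <> j -> forall i', i' < s -> i' <> j -> i < j -> j < i' -> t i = t i'.
  by move=> si ij i' si' ij' h h'; rewrite (low i) // (high' i') //; apply: t0; lia.
move=> i i' si si' ij i'j.
case: (ltngtP i j) => // h; case: (ltngtP i' j) => // h'.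
- by rewrite (low i) // (low i').
- exact: link.
- by symmetry; apply: link.
- by rewrite (high' i) // (high' i').
Qed.

Section Wheel.
Variables n m : nat.

Let M := m + n + 5.

(** The length of the cycle in row [r]. Row 0 is the center, row 1 is its link,
    and each row [r > 1] is a cycle. The lengths of the cycles are pairwise
    distinct and at least 5; rows 1 and 2 both have length [M], since the
    subtraction is truncated. *)
Definition len (r : nat) := M - (r - 2).

Definition valid (x : 'I_n.+3 * 'I_M) : bool :=
  ((x.1 == 0 :> nat) ==> (x.2 == 0 :> nat)) && (x.2 < len x.1).

Definition wvertex : finType := {x : 'I_n.+3 * 'I_M | valid x}.

Definition row (x : wvertex) : nat := (val x).1.
Definition col (x : wvertex) : nat := (val x).2.

Definition arc (r j r' j' : nat) : bool :=
  [|| (r == 0) && (r' == 1),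
      [&& r == 1, 1 < r' & j == j']
    | [&& 1 < r, r == r' & (j' == j.+1) || (j == 0) && (j' == (len r).-1)]].

Definition wadj (x y : wvertex) : bool :=
  arc (row x) (col x) (row y) (col y) || arc (row y) (col y) (row x) (col x).

Lemma wadj_sym : symmetric wadj.
Proof. by move=> x y; rewrite /wadj orbC. Qed.

Lemma vbound (x : wvertex) :
  [/\ row x < n.+3, (row x = 0 -> col x = 0) & col x < len (row x)].
Proof.
case: x => [[r j]] /= v; case/andP: (v) => /implyP h0 h1; split => //.
  by rewrite /row /=; apply: ltn_ord.
by rewrite /row /= => /eqP /h0 /eqP.
Qed.

Lemma len_big r : r < n.+3 -> 5 <= len r.
Proof. by rewrite /len /M; lia. Qed.

Lemma wadj_irrefl : irreflexive wadj.
Proof.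
move=> x; have [/len_big h _ _] := vbound x.
by rewrite /wadj orbb /arc; lia.
Qed.

Definition wheel : sgraph := SGraph wadj_sym wadj_irrefl.
Implicit Types u v x y : wheel.

Lemma vext x y : row x = row y -> col x = col y -> x = y.
Proof.
case: x y => [[r j] p] [[r' j'] p'] /= h1 h2; apply: val_inj => /=.
by congr pair; apply: val_inj.
Qed.

Lemma vertex_ex r j : r < n.+3 -> (r = 0 -> j = 0) -> j < len r ->
  exists x : wheel, row x = r /\ col x = j.
Proof.
move=> rn r0 jl; have jM : j < M by apply: leq_trans jl _; rewrite /len leq_subr.
have v : valid (Ordinal rn, Ordinal jM).
  by rewrite /valid /= jl andbT; apply/implyP => /eqP /r0 ->.
by exists (Sub (Ordinal rn, Ordinal jM) v : wvertex).
Qed.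

Lemma center_ex : exists x : wheel, row x = 0 /\ col x = 0.
Proof. by apply: vertex_ex => //; apply: leq_trans (len_big _). Qed.

Definition center : wheel := projT1 (cid center_ex).

Lemma row_center : row center = 0.
Proof. by rewrite /center; case: cid => x []. Qed.

(** The value for coordinates out of range is a default. *)
Definition vtx r j : wheel :=
  odflt center [pick x : wheel | (row x == r) && (col x == j)].

Lemma vtxE r j : r < n.+3 -> (r = 0 -> j = 0) -> j < len r ->
  row (vtx r j) = r /\ col (vtx r j) = j.
Proof.
move=> h1 h2 h3; have [x [xr xc]] := vertex_ex h1 h2 h3.
rewrite /vtx; case: pickP => [y /andP[/eqP -> /eqP ->] //|/(_ x)].
by rewrite xr xc !eqxx.
Qed.

Lemma rowc0 x : row x = 0 -> x = center.
Proof.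
move=> h; apply: vext; rewrite ?row_center //.
by have [_ -> //] := vbound x; have [_ -> //] := vbound center; apply: row_center.
Qed.

Definition cyc (s j j' : nat) : Prop :=
  j' = j.+1 \/ j = j'.+1 \/ j = 0 /\ j' = s.-1 \/ j' = 0 /\ j = s.-1.

Lemma cyc_tri s i j k : 5 <= s -> cyc s i j -> cyc s j k -> cyc s i k -> False.
Proof. rewrite /cyc; lia. Qed.

Lemma cyc_sq s i i' j j' : 5 <= s -> i < s -> i' < s -> j < s -> j' < s -> i <> i' ->
  cyc s i j -> cyc s i' j -> cyc s i j' -> cyc s i' j' -> j = j'.
Proof.
move=> s5 si si' sj sj' ne.
case=> [a|[a|[a|a]]] [b|[b|[b|b]]]; try (exfalso; lia);
  case=> [d|[d|[d|d]]]; try (exfalso; lia); case=> [e|[e|[e|e]]]; lia.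
Qed.

Lemma cyc_neighbour s i : 5 <= s -> i < s -> exists j, [/\ j < s, cyc s i j & j <> i].
Proof.
move=> s5 si; rewrite /cyc.
by case: (posnP i) => h; [exists 1|exists i.-1]; split; lia.
Qed.

Variant adj_spec (r j r' j' : nat) : Prop :=
| AdjCL of r = 0 & r' = 1
| AdjLC of r = 1 & r' = 0
| AdjLK of r = 1 & 1 < r' & j = j'
| AdjKL of 1 < r & r' = 1 & j = j'
| AdjKK of 1 < r & r = r' & cyc (len r) j j'.

Lemma adjP x y : adj x y -> adj_spec (row x) (col x) (row y) (col y).
Proof.
rewrite /= /wadj /arc.
case/orP => /or3P[/andP[/eqP a /eqP b]|/and3P[/eqP a b /eqP d]|/and3P[a /eqP b d]].
- exact: AdjCL.
- exact: AdjLK.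
- by apply: AdjKK => //; rewrite /cyc; lia.
- exact: AdjLC.
- exact: AdjKL.
- by apply: AdjKK; rewrite -?b //; rewrite /cyc; lia.
Qed.

Lemma wheel_tri u v x : adj u v -> adj v x -> adj u x -> False.
Proof.
have [/len_big lu _ _] := vbound u; have [/len_big lv _ _] := vbound v.
case/adjP=> [? ?|? ?|? ? ?|? ? ?|? r1 c1];
case/adjP=> [? ?|? ?|? ? ?|? ? ?|? r2 c2]; try lia;
case/adjP=> [? ?|? ?|? ? ?|? ? ?|? r3 c3]; try lia.
- by rewrite /cyc in c2; lia.
- by rewrite /cyc in c3; lia.
- by rewrite /cyc in c1; lia.
by rewrite -r1 in c2; apply: cyc_tri c1 c2 c3.
Qed.

Lemma wheel_sq u u' x x' : u <> u' ->
  adj u x -> adj u' x -> adj u x' -> adj u' x' -> x = x'.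
Proof.
have [/len_big lu u0 cu] := vbound u; have [/len_big lu' u0' cu'] := vbound u'.
have [/len_big lx x0 cx] := vbound x; have [/len_big lx' x0' cx'] := vbound x'.
move=> ne A1 A2 A3 A4.
have {}ne : ~ (row u = row u' /\ col u = col u') by case=> *; apply/ne/vext.
suff [h1 h2] : row x = row x' /\ col x = col x' by apply: vext.
case/adjP: A1 => [? ?|? ?|? ? ?|? ? ?|? r1 c1];
case/adjP: A2 => [? ?|? ?|? ? ?|? ? ?|? r2 c2]; try (exfalso; lia);
case/adjP: A3 => [? ?|? ?|? ? ?|? ? ?|? r3 c3]; try (exfalso; lia);
case/adjP: A4 => [? ?|? ?|? ? ?|? ? ?|? r4 c4]; try (exfalso; lia); try lia.
split; first by rewrite -r1.
have ru : row u' = row u by rewrite r2.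
rewrite ru in c2 c4 cu'; rewrite -r1 in cx; rewrite -r3 in cx'.
by apply: (cyc_sq lu cu cu' cx cx' _ c1 c2 c3 c4) => ?; apply: ne.
Qed.

Lemma adjCL x y : row x = 0 -> row y = 1 -> adj x y.
Proof. by rewrite /= /wadj /arc => -> ->. Qed.

Lemma adjLK x y : row x = 1 -> 1 < row y -> col x = col y -> adj x y.
Proof. by rewrite /= /wadj /arc => -> -> ->; rewrite !eqxx orbT. Qed.

Lemma adjKK x y : 1 < row x -> row x = row y -> cyc (len (row x)) (col x) (col y) -> adj x y.
Proof. by rewrite /= /wadj /arc /cyc => h <-; lia. Qed.

Lemma vtxK x : vtx (row x) (col x) = x.
Proof. by have [h1 h2 h3] := vbound x; apply: vext; case: (vtxE h1 h2 h3). Qed.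

Lemma vtxEpos r j : 0 < r < n.+3 -> j < len r -> row (vtx r j) = r /\ col (vtx r j) = j.
Proof. by move=> h1 h2; apply: vtxE => //; lia. Qed.

Lemma off_center u : ~~ star (center : wheel) u = (1 < row u).
Proof.
have rc := row_center; apply/idP/idP => h.
  rewrite ltnNge; apply: contra h => h; case: (posnP (row u)) => [/rowc0 ->|u0].
    by rewrite /star eqxx.
  by rewrite /star (adjCL (x := center)) ?orbT //; lia.
by apply/negP => /orP[/eqP E|/adjP[] *]; rewrite ?E in h; lia.
Qed.

Lemma col_lt_len1 x : 0 < row x -> col x < len 1.
Proof. by have [_ _] := vbound x; rewrite /len; lia. Qed.

Lemma wheel_deg2 v : exists w1 w2 : wheel, [/\ w1 <> w2, adj v w1 & adj v w2].
Proof.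
have [rn r0 cl] := vbound v; have ln := len_big rn.
case E : (row v) => [|[|r]].
- have l1 : 5 <= len 1 by apply: len_big.
  have [a1 b1] : row (vtx 1 0) = 1 /\ col (vtx 1 0) = 0 by apply: vtxEpos; lia.
  have [a2 b2] : row (vtx 1 1) = 1 /\ col (vtx 1 1) = 1 by apply: vtxEpos; lia.
  exists (vtx 1 0), (vtx 1 1); split; [|exact: adjCL|exact: adjCL].
  by move=> F; rewrite F b2 in b1.
- have [a2 b2] : row (vtx 2 (col v)) = 2 /\ col (vtx 2 (col v)) = col v.
    by apply: vtxEpos; rewrite ?E in cl *; rewrite /len in cl *; lia.
  exists center, (vtx 2 (col v)); split.
  + by move=> F; have := row_center; rewrite F a2.
  + by rewrite adj_sym adjCL // row_center.
  + by rewrite adjLK ?a2.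
have rv : 1 < row v by rewrite E.
have c1 := col_lt_len1 (ltnW rv).
have [a1 b1] : row (vtx 1 (col v)) = 1 /\ col (vtx 1 (col v)) = col v by apply: vtxEpos.
have [j [jl jc _]] := cyc_neighbour ln cl.
have [a2 b2] : row (vtx (row v) j) = row v /\ col (vtx (row v) j) = j.
  by apply: vtxEpos; lia.
exists (vtx 1 (col v)), (vtx (row v) j); split.
- by move=> F; rewrite F a2 in a1; lia.
- by rewrite adj_sym adjLK.
- by apply: adjKK; rewrite ?a2 ?b2.
Qed.

Section Constancy.
Variable X : Type.
Implicit Types t : wheel -> X.

Lemma row_const v t r j : 1 < r < n.+3 -> locally_constant v t ->
  (forall i, i < len r -> i <> j -> ~~ star v (vtx r i)) ->
  forall i i', i < len r -> i' < len r -> i <> j -> i' <> j -> t (vtx r i) = t (vtx r i').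
Proof.
move=> hr lt off; have l5 : 5 <= len r by apply: len_big; lia.
have E i : i < len r -> row (vtx r i) = r /\ col (vtx r i) = i.
  by move=> h; apply: vtxEpos; lia.
apply: (cycle_minus_constant (t := fun i => t (vtx r i))) => [i si ij i'j|j0 j1].
  have [a1 b1] := E i (ltnW si); have [a2 b2] := E _ si.
  apply: lt; [exact: off (ltnW si) ij|exact: off|].
  by apply: adjKK; rewrite ?a1 ?a2 ?b1 ?b2 /cyc; lia.
have [a1 b1] : row (vtx r 0) = r /\ col (vtx r 0) = 0 by apply: E; lia.
have [a2 b2] : row (vtx r (len r).-1) = r /\ col (vtx r (len r).-1) = (len r).-1.
  by apply: E; lia.
apply: lt; [by apply: off; lia|by apply: off; lia|].
by apply: adjKK; rewrite ?a1 ?a2 ?b1 ?b2 /cyc; lia.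
Qed.

Lemma component_const t : locally_constant (center : wheel) t ->
  forall u u', ~~ star (center : wheel) u -> ~~ star (center : wheel) u' ->
  row u = row u' -> t u = t u'.
Proof.
move=> lt u u'; rewrite !off_center => ru ru' E.
have [rn _ cu] := vbound u; have [_ _ cu'] := vbound u'.
rewrite -(vtxK u) -(vtxK u') -E; rewrite -E in cu'.
apply: (row_const (v := center) (j := len (row u))) => //; try lia.
have h : 0 < row u < n.+3 by lia.
by move=> i hi _; rewrite off_center (vtxEpos h hi).1.
Qed.

(** Suppose that a star other than that of the center is deleted. If it is the
    star of a vertex of a cycle, every remaining vertex reaches the center,
    directly through row 1 or after one step along its cycle. If it is the star
    of the vertex [j] of row 1, column [j] and the center disappear; every other
    vertex is joined through row 1 to the first cycle, which is a path now. *)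
Lemma wheel_conn v t : v <> center -> locally_constant v t ->
  forall u u', ~~ star v u -> ~~ star v u' -> t u = t u'.
Proof.
move=> vc lt; have [rn _ cv] := vbound v.
have rv : 0 < row v by rewrite lt0n; apply/eqP => /rowc0.
have sp x : 0 < row x -> row (vtx 1 (col x)) = 1 /\ col (vtx 1 (col x)) = col x.
  by move=> h; apply: vtxEpos => //; apply: col_lt_len1.
have off x y : (row y <> row v \/ col y <> col v) ->
    (adj v y -> False) -> ~~ star v y.
  move=> ne na; apply/negP => /orP[/eqP E|/na //].
  by case: ne; rewrite E.
case: (ltnP 1 (row v)) => rv1.
  suff to_c u : ~~ star v u -> t u = t center.
    by move=> u u' /to_c -> /to_c ->.
  have cc : ~~ star v center.
    apply: off => //; first by left; rewrite row_center; lia.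
    by move=> /adjP[] *; have := row_center; lia.
  have offL x : col x <> col v -> row x = 1 -> t x = t center.
    move=> cx rx; apply: lt => //; last by rewrite adj_sym adjCL // row_center.
    by apply: off => //; [right|move=> /adjP[] *; lia].
  have offK x : col x <> col v -> 1 < row x -> ~~ star v x -> t x = t center.
    move=> cx rx ox; have [a b] := sp x (ltnW rx).
    rewrite -(offL (vtx 1 (col x))) ?b //; apply: lt => //.
      by apply: off => //; [right; rewrite b|move=> /adjP[] *; lia].
    by rewrite adj_sym adjLK.
  move=> ou; have [run _ cu] := vbound u.
  case: (posnP (row u)) => [/rowc0 -> //|ru].
  case: (ltnP 1 (row u)) => ru1; last first.
    apply: offL; last by lia.
    move=> E; case/negP: ou; rewrite /star [adj v u]adj_sym (adjLK (x := u)) ?orbT //; lia.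
  case: (eqVneq (col u) (col v)) => [E|/eqP]; last by move=> /offK; apply.
  have [j [jl jc ju]] := cyc_neighbour (len_big run) cu.
  have [a2 b2] : row (vtx (row u) j) = row u /\ col (vtx (row u) j) = j.
    by apply: vtxEpos; lia.
  have ruv : row u <> row v.
    by move=> F; case/negP: ou; rewrite /star (vext F E) eqxx.
  have jv : j <> col v by rewrite -E.
  have oz : ~~ star v (vtx (row u) j).
    by apply: off => //; [left; rewrite a2|move=> /adjP[] *; lia].
  rewrite -(offK (vtx (row u) j)) ?a2 ?b2 //; apply: lt => //.
  by apply: adjKK; rewrite ?a2 ?b2.
have {rv rv1}rv : row v = 1 by lia.
have cv2 : col v < len 2 by have := col_lt_len1 (x := v); rewrite rv /len; lia.
have offE u : ~~ star v u -> 0 < row u /\ col u <> col v.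
  move=> ou; split.
    rewrite lt0n; apply/eqP => u0; case/negP: ou.
    by rewrite /star [adj v u]adj_sym (adjCL (x := u)) ?orbT.
  move=> E; case/negP: ou; case: (ltnP 1 (row u)) => ru.
    by rewrite /star (adjLK (x := v)) ?orbT.
  rewrite /star; case: (posnP (row u)) => [u0|u0].
    by rewrite [adj v u]adj_sym (adjCL (x := u)) ?orbT.
  by rewrite (@vext u v) ?eqxx //; lia.
have offI u : 0 < row u -> col u <> col v -> ~~ star v u.
  by move=> ru cu; apply: off => //; [right|move=> /adjP[] *; lia].
have len12 i : i < len 1 -> i < len 2 by rewrite /len; lia.
have s2 x : 0 < row x -> row (vtx 2 (col x)) = 2 /\ col (vtx 2 (col x)) = col x.
  by move=> h; apply: vtxEpos => //; apply/len12/col_lt_len1.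
have to2 u : ~~ star v u -> t u = t (vtx 2 (col u)).
  move=> ou; have [ru cu] := offE _ ou; have [a1 b1] := sp _ ru; have [a2 b2] := s2 _ ru.
  have -> : t u = t (vtx 1 (col u)).
    case: (ltnP 1 (row u)) => ru1; last first.
      by congr t; apply: vext; rewrite ?a1 ?b1 //; lia.
    by apply: lt => //; [apply: offI; rewrite ?a1 ?b1|rewrite adj_sym adjLK].
  apply: lt; [by apply: offI; rewrite ?a1 ?b1|by apply: offI; rewrite ?a2 ?b2|].
  by rewrite adjLK ?a1 ?a2 ?b1 ?b2.
move=> u u' ou ou'; rewrite (to2 u) // (to2 u') //.
have [ru cu] := offE _ ou; have [ru' cu'] := offE _ ou'.
apply: (row_const (v := v) (j := col v)) => //.
- move=> i hi ne; have [|a b] := @vtxEpos 2 i _ hi; first by [].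
  by apply: offI; rewrite ?a ?b.
- exact/len12/col_lt_len1.
- exact/len12/col_lt_len1.
Qed.

End Constancy.

Local Notation c := (center : wheel).

(** The index of the component of the complement of the star of the center. On
    the star itself the value is a default. *)
Definition branch u : 'I_n.+1 := inord (row u - 2).
Definition rep (i : 'I_n.+1) : wheel := vtx (i + 2) 0.

Lemma branch_row u : ~~ star c u -> row u = branch u + 2.
Proof.
rewrite off_center => h; have [hr _ _] := vbound u.
by rewrite /branch inordK; lia.
Qed.

Lemma rep_row i : row (rep i) = i + 2.
Proof.
have hr : 0 < i + 2 < n.+3 by have := ltn_ord i; lia.
by apply: (vtxEpos hr _).1; apply: leq_trans (len_big _); lia.
Qed.

Lemma rep_off i : ~~ star c (rep i).
Proof. by rewrite off_center rep_row; lia. Qed.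

Lemma repK : cancel rep branch.
Proof. by move=> i; apply: ord_inj; have := branch_row (rep_off i); rewrite rep_row; lia. Qed.

Lemma branch_lc : locally_constant c branch.
Proof.
move=> u u'; rewrite !off_center => h h' /adjP[] *; try lia.
by rewrite /branch; congr inord; lia.
Qed.

Lemma branch_conn (X : Type) (t : wheel -> X) : locally_constant c t ->
  forall u u', ~~ star c u -> ~~ star c u' -> branch u = branch u' -> t u = t u'.
Proof.
by move=> lt u u' cu cu' E; apply: component_const => //; rewrite !branch_row ?E.
Qed.

Definition component (i : 'I_n.+1) : {set wheel} := [set x | row x == i + 2].

Lemma card_component i : #|component i| = len (i + 2).
Proof.
have hr : 0 < i + 2 < n.+3 by have := ltn_ord i; lia.
have -> : component i = [set vtx (i + 2) j | j : 'I_(len (i + 2))].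
  apply/setP => x; rewrite inE; apply/eqP/imsetP => [E|[j _ ->]].
    have [_ _ cx] := vbound x; rewrite E in cx.
    by exists (Ordinal cx); rewrite //= -[LHS]vtxK E.
  exact: (vtxEpos hr (ltn_ord j)).1.
rewrite card_imset ?card_ord // => j j' E; apply: ord_inj.
by rewrite -(vtxEpos hr (ltn_ord j)).2 E (vtxEpos hr (ltn_ord j')).2.
Qed.

Lemma card_wheel : m < #|wheel|.
Proof.
apply: leq_trans (max_card (mem (component ord0))); rewrite card_component /len /M /=.
by lia.
Qed.

Hypothesis n0 : 0 < n.

Section Symmetry.
Variable r : wheel -> wheel.
Hypotheses (rb : bijective r) (radj : forall u v, adj (r u) (r v) = adj u v).

Lemma star_sym u v : star (r u) (r v) = star u v.
Proof. by rewrite /star radj (bij_eq rb). Qed.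

(** The center is the only vertex whose star disconnects the graph. If it moved,
    the component index, transported by [r], would be locally constant and not
    constant off the star of another vertex. *)
Lemma center_fixed : r c = c.
Proof.
apply: contrapT => rc; have [r' rK r'K] := rb.
have lt : locally_constant (r c) (fun x => branch (r' x)).
  move=> u u'; rewrite -{1}(r'K u) -{1}(r'K u') !star_sym => cu cu' uu'.
  by apply: branch_lc => //; rewrite -radj !r'K.
have E := wheel_conn rc lt; have := E (r (rep ord0)) (r (rep ord_max)).
rewrite !star_sym !rK !repK !rep_off => /(_ isT isT) /(congr1 val) /= ?; lia.
Qed.

(** A component is mapped injectively into a component, and larger indices belong
    to smaller components. *)
Lemma branch_le u : ~~ star c u -> branch (r u) <= branch u.
Proof.
move=> cu; have sr v : star c (r v) = star c v by rewrite -{1}center_fixed star_sym.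
have lt : locally_constant c (fun x => branch (r x)).
  by move=> v v' cv cv' vv'; apply: branch_lc; rewrite ?sr ?radj.
have sub : [set r x | x in component (branch u)] \subset component (branch (r u)).
  apply/subsetP => _ /imsetP[x + ->]; rewrite !inE => /eqP rx.
  have cx : ~~ star c x by rewrite off_center rx; lia.
  rewrite branch_row ?sr // (branch_conn lt cx cu) //.
  by apply: ord_inj; have := branch_row cx; lia.
have := subset_leq_card sub; rewrite card_imset; last exact: bij_inj.
rewrite !card_component /len.
by have := ltn_ord (branch (r u)); have := ltn_ord (branch u); lia.
Qed.

End Symmetry.

(** Both [r] and its inverse satisfy [branch_le]. *)
Lemma wheel_sym (r : wheel -> wheel) : bijective r ->
  (forall u v, adj (r u) (r v) = adj u v) ->
  r c = c /\ forall u, ~~ star c u -> branch (r u) = branch u.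
Proof.
move=> rb radj; have rc := center_fixed rb radj; split=> // u cu.
have [r' rK r'K] := rb; apply: ord_inj; apply/eqP; rewrite eqn_leq branch_le //=.
rewrite -{1}(rK u); apply: branch_le; first by exists r.
  by move=> x y; rewrite -radj !r'K.
by rewrite -{1}rc (star_sym rb radj).
Qed.

Lemma wheel_focused : focused wheel.
Proof.
exists c; split.
- move=> u v /(no_domination wheel_tri wheel_sq wheel_deg2) -> //.
- move=> /connected_del_constant C.
  have lt : locally_constant c (fun x => branch x == ord0).
    by move=> u v cu cv uv; rewrite (branch_lc cu cv uv).
  have := C _ lt (rep ord0) (rep ord_max) (rep_off _) (rep_off _).
  by rewrite !repK eqxx => /esym/eqP/(congr1 val) /= ?; lia.
- by move=> v vc; apply: connected_del => t; apply: wheel_conn.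
Qed.

Lemma wheel_PGL : contains_copy (Out (Out (raag wheel))) (PGLZ n).
Proof.
apply: (Out_Out_contains_PGL wheel_tri wheel_sq wheel_deg2
  (c := c) (branch := branch) (rep := rep)).
- by move=> v vc t; apply: wheel_conn.
- exact: branch_lc.
- by move=> t; apply: branch_conn.
- exact: rep_off.
- exact: repK.
- exact: wheel_sym.
Qed.

End Wheel.

Theorem theorem1 (n : nat) (hn : 2 <= n) :
  exists F : nat -> sgraph,
    (forall i j : nat, i <> j -> ~ sgraph_iso (F i) (F j)) /\
    (forall i : nat,
       focused (F i) /\ contains_copy (Out (Out (raag (F i)))) (PGLZ n)).
Proof.
(* Each graph has more vertices than its size parameter, so feeding the number of
   vertices of one graph into the next makes these numbers strictly increase. *)
pose size_seq i := iter i (fun m => #|wheel n m|) 0.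
exists (fun i => wheel n (size_seq i)); split; last first.
  by move=> i; split; [apply: wheel_focused|apply: wheel_PGL]; apply: ltnW.
have incr : {homo size_seq : i j / i < j}.
  apply: homo_ltn => [y x z|i]; first exact: ltn_trans.
  exact: (card_wheel n (size_seq i)).
have ne i j : i < j -> #|wheel n (size_seq i)| <> #|wheel n (size_seq j)|.
  move=> ij E; have : size_seq i.+1 < size_seq j.+1 by apply: incr.
  by rewrite -[size_seq j.+1]/#|wheel n (size_seq j)| -E ltnn.
move=> i j ij [f [fb _]]; have E := bij_eq_card fb.
by case: (ltngtP i j) ij => // h _; [apply: (ne _ _ h)|apply: (ne _ _ h)].
Qed.
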